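(* Let the vertices of an octahedron be labelled by $(ik)=(ki)$, $i\neq k\in\{1,2,3,4\}$, such that opposite vertices carry complementary indices. Let two generalized Clifford configurations in $\mathbb{R}^4\cong\mathbb{H}$ have the points $\Phi_{12},\Phi_{13},\Phi_{14},\Phi_{23},\Phi_{24}$ in common (at the vertices with the same labels) and have the points $\Phi_{34}$ and $\tilde\Phi_{34}$ respectively at the vertex $(34)$, where $$M(\Phi_{14},\Phi_{12},\Phi_{24},\Phi_{23},\Phi_{34},\Phi_{13})=-1,\qquad \tilde M(\Phi_{14},\Phi_{12},\Phi_{24},\Phi_{23},\tilde\Phi_{34},\Phi_{13})=-1 .$$ If these configurations are not conformally equivalent to a classical Clifford configuration, then the points $\Phi_{34}$ and $\tilde\Phi_{34}$ are related by inversion with respect to the (well-defined) hypersphere passing through the common points $\Phi_{13},\Phi_{14},\Phi_{12},\Phi_{24},\Phi_{23}$.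
   Context: $\mathbb{R}^4$ is identified with the quaternions $\mathbb{H}$ via $(a,b,c,d)\leftrightarrow a+b\,\mathbf{i}+c\,\mathbf{j}+d\,\mathbf{k}$. For quaternions $P_1,\dots,P_6$ (with the inverses existing), $$M(P_1,\dots,P_6)=(P_1-P_2)(P_2-P_3)^{-1}(P_3-P_4)(P_4-P_5)^{-1}(P_5-P_6)(P_6-P_1)^{-1},$$ $$\tilde M(P_1,\dots,P_6)=(P_1-P_6)^{-1}(P_6-P_5)(P_5-P_4)^{-1}(P_4-P_3)(P_3-P_2)^{-1}(P_2-P_1).$$ **Octahedral point-circle configuration.** A configuration of six (distinct) points and eight circles in $\mathbb{R}^4$ with the combinatorics of an octahedron: the points correspond to the vertices, the circles to the triangular faces, and a circle passes through a point of the configuration iff the corresponding face contains the corresponding vertex (so three points on every circle, four circles through every point). As usual in inversive geometry, straight lines count as circles (through $\infty$), and hyperplanes as hyperspheres, inversion in a hyperplane being reflection. Two vertices are opposite if not joined by an edge; two faces are opposite if disjoint. The opposite point of $P$ and the opposite circle of $S$ are denoted by $P^*$, $S^*$. **Correspondence.** Consider pairs $(S;P)$ of a circle $S$ of the configuration and a point $P$ of the configuration on $S$. If the circles $S_1\ne S_2$ both pass through the points $P_1\neq P_2$ of the configuration (i.e. their faces share the edge $P_1P_2$), then $S_1$ at $P_1$ corresponds to $S_2$ at $P_2$, and $S_2$ at $P_1$ corresponds to $S_1$ at $P_2$. Moreover, $S$ at $P$ corresponds to $S^*$ at $P^*$. The equivalence relation generated by these rules has four classes, each containing exactly one circle at each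 of the six points. Circles at different points are called corresponding if they are in the same class. **Orientation.** The circles are oriented so that the induced orientations of the faces of the octahedron (given by the cyclic order in which the circle passes through its three points) all agree when viewed from outside, i.e. neighbouring faces induce opposite directions on their common edge. **Angles.** The angle $\angle(S,S')$ of two oriented circles through a point $P$ is the Euclidean angle in $[0,\pi]$ between their tangent vectors at $P$ pointing in the direction of the orientations. **Generalized Clifford configuration.** An octahedral point-circle configuration with points $P_1,\dots,P_6$ such that for any two classes of corresponding circles, with $S_k,S'_k$ denoting their members at $P_k$, the angle $\angle(S_k,S_k')$ is independent of $k=1,\dots,6$. **Classical Clifford configuration.** Take four generic circles $S_1,S_2,S_3,S_4$ in a plane passing through a point $P$ (lines through $P=\infty$ being allowed); let $P_{ik}$ be the second point of intersection of $S_i$ and $S_k$, and let $S_{ikl}$ be the circle through $P_{ik},P_{il},P_{kl}$. The classical ($\mathcal{C}_4$) Clifford configuration is regarded as the configuration of the six points $P_{ik}$ and the eight circles $S_i$, $S_{ikl}$. (By Clifford's theorem, the four circles $S_{123},S_{124},S_{134},S_{234}$ also meet in a point.) **Conformal equivalence** refers to the group of conformal transformations of $\mathbb{R}^4\cup\{\infty\}$ (generated by translations, orthogonal maps, scalings and inversions). *)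

(* Defs.v *)
From HB Require Import structures.
From Stdlib Require Import Relation_Operators.
From mathcomp Require Import all_boot all_order all_algebra.
From mathcomp Require Import ring lra.
From mathcomp Require Import all_classical all_reals all_analysis.

Set Implicit Arguments.
Unset Strict Implicit.
Unset Printing Implicit Defensive.

Import Order.TTheory GRing.Theory Num.Theory.
Local Open Scope classical_set_scope.
Local Open Scope ring_scope.

(* R^4 with the quaternion product, a + b i + c j + d k being the row
   (a, b, c, d).  The norm that MathComp-Analysis puts on 'rV_4 is the sup norm;
   all Euclidean notions below go through [dot]. *)
Definition quaternion (R : realType) : Type := 'rV[R]_4.

HB.instance Definition _ (R : realType) := GRing.Lmodule.on (quaternion R).

Definition quat (R : realType) (a b c d : R) : quaternion R :=
  \row_(i < 4) [:: a; b; c; d]`_i.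

Definition re (R : realType) (x : quaternion R) : R := x 0 (inord 0).
Definition imi (R : realType) (x : quaternion R) : R := x 0 (inord 1).
Definition imj (R : realType) (x : quaternion R) : R := x 0 (inord 2).
Definition imk (R : realType) (x : quaternion R) : R := x 0 (inord 3).

Definition dot (R : realType) (x y : quaternion R) : R :=
  \sum_(i < 4) x 0 i * y 0 i.

Definition qmul (R : realType) (x y : quaternion R) : quaternion R :=
  quat (re x * re y - imi x * imi y - imj x * imj y - imk x * imk y)
       (re x * imi y + imi x * re y + imj x * imk y - imk x * imj y)
       (re x * imj y - imi x * imk y + imj x * re y + imk x * imi y)
       (re x * imk y + imi x * imj y - imj x * imi y + imk x * re y).

Definition qconj (R : realType) (x : quaternion R) : quaternion R :=
  quat (re x) (- imi x) (- imj x) (- imk x).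

Definition qinv (R : realType) (x : quaternion R) : quaternion R :=
  (dot x x)^-1 *: qconj x.

Lemma quatE (R : realType) (a b c d : R) :
  (re (quat a b c d) = a) * (imi (quat a b c d) = b) *
  (imj (quat a b c d) = c) * (imk (quat a b c d) = d).
Proof. by rewrite /re /imi /imj /imk !mxE !inordK. Qed.

Lemma quat_eqP (R : realType) (x y : quaternion R) :
  re x = re y -> imi x = imi y -> imj x = imj y -> imk x = imk y -> x = y.
Proof.
move=> h0 h1 h2 h3; apply/rowP => i; rewrite -(inord_val i).
by case: i => -[|[|[|[|//]]]] ? /=.
Qed.

Lemma quatD (R : realType) (x y : quaternion R) :
  (re (x + y) = re x + re y) * (imi (x + y) = imi x + imi y) *
  (imj (x + y) = imj x + imj y) * (imk (x + y) = imk x + imk y).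
Proof. by rewrite /re /imi /imj /imk !mxE. Qed.

Lemma quatZ (R : realType) (k : R) (x : quaternion R) :
  (re (k *: x) = k * re x) * (imi (k *: x) = k * imi x) *
  (imj (k *: x) = k * imj x) * (imk (k *: x) = k * imk x).
Proof. by rewrite /re /imi /imj /imk !mxE. Qed.

Lemma quat0 (R : realType) :
  (re (0 : quaternion R) = 0) * (imi (0 : quaternion R) = 0) *
  (imj (0 : quaternion R) = 0) * (imk (0 : quaternion R) = 0).
Proof. by rewrite /re /imi /imj /imk !mxE. Qed.

Lemma dotE (R : realType) (x y : quaternion R) :
  dot x y = re x * re y + imi x * imi y + imj x * imj y + imk x * imk y.
Proof.
rewrite /dot /re /imi /imj /imk !big_ord_recl big_ord0 addr0 !addrA.
by do ![congr (_ + _)]; congr (x 0 _ * y 0 _);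
   apply/val_inj; rewrite /= inordK.
Qed.

Lemma qmulA (R : realType) : associative (@qmul R).
Proof. by move=> x y z; apply: quat_eqP; rewrite !quatE; ring. Qed.

Lemma qmul1r (R : realType) : left_id (quat 1 0 0 0) (@qmul R).
Proof. by move=> x; apply: quat_eqP; rewrite !quatE; ring. Qed.

Lemma qmulr1 (R : realType) : right_id (quat 1 0 0 0) (@qmul R).
Proof. by move=> x; apply: quat_eqP; rewrite !quatE; ring. Qed.

Lemma qmulDl (R : realType) : left_distributive (@qmul R) +%R.
Proof. by move=> x y z; apply: quat_eqP; rewrite !(quatD, quatE); ring. Qed.

Lemma qmulDr (R : realType) : right_distributive (@qmul R) +%R.
Proof. by move=> x y z; apply: quat_eqP; rewrite !(quatD, quatE); ring. Qed.

Lemma quat1_neq0 (R : realType) : quat 1 0 0 0 != 0 :> quaternion R.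
Proof.
apply/eqP => /(congr1 (@re R)); rewrite quatE quat0 => /eqP.
by rewrite oner_eq0.
Qed.

HB.instance Definition _ (R : realType) :=
  GRing.Zmodule_isNzRing.Build (quaternion R)
    (@qmulA R) (@qmul1r R) (@qmulr1 R) (@qmulDl R) (@qmulDr R) (@quat1_neq0 R).

Lemma dot_eq0 (R : realType) (x : quaternion R) : (dot x x == 0) = (x == 0).
Proof.
apply/eqP/eqP => [|->]; rewrite dotE ?quat0; last by ring.
by move=> h; apply: quat_eqP; rewrite quat0; nra.
Qed.

Lemma qmulVr (R : realType) :
  {in [pred x : quaternion R | x != 0], left_inverse 1 (@qinv R) *%R}.
Proof.
move=> x; rewrite inE -dot_eq0 dotE => h.
by apply: quat_eqP; rewrite !(quatZ, quatE) !dotE; field.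
Qed.

Lemma qmulrV (R : realType) :
  {in [pred x : quaternion R | x != 0], right_inverse 1 (@qinv R) *%R}.
Proof.
move=> x; rewrite inE -dot_eq0 dotE => h.
by apply: quat_eqP; rewrite !(quatZ, quatE) !dotE; field.
Qed.

Lemma qunitP (R : realType) (x y : quaternion R) :
  y * x = 1 /\ x * y = 1 -> [pred z : quaternion R | z != 0] x.
Proof.
move=> [yx _]; rewrite /=; apply/eqP => x0; move: yx; rewrite x0 mulr0.
by move/esym/eqP; rewrite oner_eq0.
Qed.

Lemma qinv_out (R : realType) :
  {in [predC [pred x : quaternion R | x != 0]], @qinv R =1 id}.
Proof.
move=> x; rewrite !inE negbK => /eqP ->.
by apply: quat_eqP; rewrite !(quatZ, quatE, quat0); ring.
Qed.

HB.instance Definition _ (R : realType) :=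
  GRing.NzRing_hasMulInverse.Build (quaternion R)
    (@qmulVr R) (@qmulrV R) (@qunitP R) (@qinv_out R).

Definition multiratio (R : realType) (P1 P2 P3 P4 P5 P6 : quaternion R) :=
  (P1 - P2) * (P2 - P3)^-1 * (P3 - P4) * (P4 - P5)^-1 *
  (P5 - P6) * (P6 - P1)^-1.

Definition multiratio_tilde (R : realType) (P1 P2 P3 P4 P5 P6 : quaternion R) :=
  (P1 - P6)^-1 * (P6 - P5) * (P5 - P4)^-1 * (P4 - P3) *
  (P3 - P2)^-1 * (P2 - P1).

(* R^4 with a point at infinity, [None]. *)
Definition epoint (R : realType) : Type := option (quaternion R).

Definition orthonormal2 (R : realType) (u v : quaternion R) : Prop :=
  [/\ dot u u = 1, dot v v = 1 & dot u v = 0].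

(* [OCircle c u v r] runs through c + r cos t u + r sin t v, and [OLine p u]
   through p + t u, for increasing t.  Different data may describe the same
   oriented circle. *)
Inductive ocircle (R : realType) : Type :=
| OCircle of quaternion R & quaternion R & quaternion R & R
| OLine of quaternion R & quaternion R.

Definition ocircle_ok (R : realType) (C : ocircle R) : Prop :=
  match C with
  | OCircle c u v r => orthonormal2 u v /\ 0 < r
  | OLine p u => dot u u = 1
  end.

Definition param (R : realType) (C : ocircle R) (t : R) : quaternion R :=
  match C with
  | OCircle c u v r => c + (r * cos t) *: u + (r * sin t) *: v
  | OLine p u => p + t *: u
  end.

Definition carrier (R : realType) (C : ocircle R) : set (epoint R) :=
  match C with
  | OCircle _ _ _ _ => [set Some (param C t) | t in [set: R]]
  | OLine _ _ => None |` [set Some (param C t) | t in [set: R]]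
  end.

Definition is_circle (R : realType) (X : set (epoint R)) : Prop :=
  exists2 C : ocircle R, ocircle_ok C & carrier C = X.

(* The derivative of [param C] at the parameter of the point x. *)
Definition tangent (R : realType) (C : ocircle R) (x : quaternion R) :
    quaternion R :=
  match C with
  | OCircle c u v r => dot (x - c) u *: v - dot (x - c) v *: u
  | OLine p u => u
  end.

Definition angle (R : realType) (C D : ocircle R) (x : quaternion R) : R :=
  let s := tangent C x in let t := tangent D x in
  acos (dot s t / (Num.sqrt (dot s s) * Num.sqrt (dot t t))).

(* C passes through the points x, y, z in this cyclic order. *)
Definition cyclic_order (R : realType) (C : ocircle R) (x y z : quaternion R) :
    Prop :=
  exists a b c : R, [/\ param C a = x, param C b = y, param C c = z &
    match C with
    | OCircle _ _ _ _ => [&& a < b, b < c & c < a + 2 * pi]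
    | OLine _ _ => [|| a < b < c, b < c < a | c < a < b]
    end].

Inductive vertex : Type := V12 | V13 | V14 | V23 | V24 | V34.

Inductive face : Type := F1 | F2 | F3 | F4 | F234 | F134 | F124 | F123.

(* The face Fi contains the three vertices with index i, and Fikl the vertices
   ik, il, kl. *)
Definition contains (f : face) (v : vertex) : bool :=
  match f, v with
  | F1, (V12 | V13 | V14) | F234, (V23 | V24 | V34)
  | F2, (V12 | V23 | V24) | F134, (V13 | V14 | V34)
  | F3, (V13 | V23 | V34) | F124, (V12 | V14 | V24)
  | F4, (V14 | V24 | V34) | F123, (V12 | V13 | V23) => true
  | _, _ => false
  end.

Definition oppv (v : vertex) : vertex :=
  match v with
  | V12 => V34 | V34 => V12 | V13 => V24
  | V24 => V13 | V14 => V23 | V23 => V14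
  end.

Definition oppf (f : face) : face :=
  match f with
  | F1 => F234 | F234 => F1 | F2 => F134 | F134 => F2
  | F3 => F124 | F124 => F3 | F4 => F123 | F123 => F4
  end.

(* (f, v) stands for the circle of f at the point of v. *)
Inductive corr_step : face * vertex -> face * vertex -> Prop :=
| corr_edge (f g : face) (v w : vertex) :
    f <> g -> v <> w ->
    contains f v -> contains f w -> contains g v -> contains g w ->
    corr_step (f, v) (g, w)
| corr_opp (f : face) (v : vertex) :
    contains f v -> corr_step (f, v) (oppf f, oppv v).

Definition corresponding : face * vertex -> face * vertex -> Prop :=
  clos_refl_sym_trans (face * vertex) corr_step.

Definition octahedral (R : realType)
    (Phi : vertex -> quaternion R) (S : face -> ocircle R) : Prop :=
  [/\ injective Phi, forall f, ocircle_ok (S f) &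
      forall f v, carrier (S f) (Some (Phi v)) <-> contains f v].

(* Neighbouring faces f = vwx and g = wvy induce opposite directions on their
   common edge vw; there are two such choices of orientations, which give the
   same angles. *)
Definition coherently_oriented (R : realType)
    (Phi : vertex -> quaternion R) (S : face -> ocircle R) : Prop :=
  forall (f g : face) (v w x y : vertex),
    f <> g -> v <> w -> x <> v -> x <> w -> y <> v -> y <> w ->
    contains f v -> contains f w -> contains f x ->
    contains g v -> contains g w -> contains g y ->
    (cyclic_order (S f) (Phi v) (Phi w) (Phi x) <->
     cyclic_order (S g) (Phi w) (Phi v) (Phi y)).

Definition generalized_clifford (R : realType)
    (Phi : vertex -> quaternion R) (S : face -> ocircle R) : Prop :=
  [/\ octahedral Phi S, coherently_oriented Phi S &
      forall (f g f' g' : face) (v w : vertex),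
        contains f v -> contains g v -> contains f' w -> contains g' w ->
        corresponding (f, v) (f', w) -> corresponding (g, v) (g', w) ->
        angle (S f) (S g) (Phi v) = angle (S f') (S g') (Phi w)].

Inductive hypersphere (R : realType) : Type :=
| Sphere of quaternion R & R
| Hyperplane of quaternion R & R.

Definition hypersphere_ok (R : realType) (H : hypersphere R) : Prop :=
  match H with
  | Sphere c r => 0 < r
  | Hyperplane n d => dot n n = 1
  end.

Definition hypersphere_set (R : realType) (H : hypersphere R) :
    set (epoint R) :=
  match H with
  | Sphere c r => [set Some x | x in [set x | dot (x - c) (x - c) = r ^+ 2]]
  | Hyperplane n d => None |` [set Some x | x in [set x | dot n x = d]]
  end.

Definition inversion (R : realType) (H : hypersphere R) (z : epoint R) :
    epoint R :=
  match H, z with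
  | Sphere c r, Some x =>
      if x == c then None
      else Some (c + (r ^+ 2 / dot (x - c) (x - c)) *: (x - c))
  | Sphere c r, None => Some c
  | Hyperplane n d, Some x => Some (x - (2 * (dot n x - d)) *: n)
  | Hyperplane n d, None => None
  end.

Inductive conformal (R : realType) : (epoint R -> epoint R) -> Prop :=
| conformal_translation (a : quaternion R) :
    conformal (omap (fun x : quaternion R => x + a))
| conformal_orthogonal (A : 'M[R]_4) :
    A *m A^T = 1%:M -> conformal (omap (fun x : quaternion R => x *m A))
| conformal_scaling (k : R) :
    0 < k -> conformal (omap (fun x : quaternion R => k *: x))
| conformal_inversion (H : hypersphere R) :
    hypersphere_ok H -> conformal (inversion H)
| conformal_comp (g h : epoint R -> epoint R) :
    conformal g -> conformal h -> conformal (g \o h).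

Definition eplane (R : realType) (p u v : quaternion R) : set (epoint R) :=
  None |` [set Some (p + st.1 *: u + st.2 *: v) | st in [set: R * R]].

Definition star_face (f : face) : bool :=
  match f with F1 | F2 | F3 | F4 => true | _ => false end.

(* The circles S_i are the T Fi, the S_ikl are the T Fikl, and P is the common
   point of the S_i.  Genericity: S_i and S_k meet in a second point P_ik, and
   the six points P_ik are distinct.  All points may be at infinity. *)
Definition classical_clifford (R : realType)
    (Q : vertex -> epoint R) (T : face -> set (epoint R)) : Prop :=
  exists (p u v : quaternion R) (P : epoint R),
    [/\ orthonormal2 u v /\
          (forall f, star_face f -> T f `<=` eplane p u v),
        forall f, is_circle (T f),
        injective Q /\ (forall w, Q w <> P),
        forall f g w, star_face f -> star_face g -> f <> g ->
          contains f w -> contains g w -> T f `&` T g = [set P; Q w] &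
        forall f w, ~~ star_face f -> contains f w -> T f (Q w)].

(* Equivalence of the unlabelled configurations, i.e. of the set of points and
   the set of circles. *)
Definition conformally_classical (R : realType)
    (Phi : vertex -> quaternion R) (S : face -> ocircle R) : Prop :=
  exists (Q : vertex -> epoint R) (T : face -> set (epoint R))
         (g : epoint R -> epoint R),
    [/\ classical_clifford Q T, conformal g,
        range (fun w => g (Some (Phi w))) = range Q &
        range (fun f => g @` carrier (S f)) = range T].

(* Main.v *)
(* The inversion x -> (x - Phi_12)^-1 sends Phi_12 to infinity; let a, b, c, d,
   e, e' be the images of Phi_13, Phi_14, Phi_23, Phi_24, Phi_34, Phi'_34, and put
   w = a - b, v = d - c.  The two multi-ratio conditions become
   e - a = (c - e) v^-1 w and e' - a = w v^-1 (c - e').  A reflection fixing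
   a, b, c, d turns the first equation into the second, whose solution is
   unique, so it maps e to e'; hyperplanes through a, b, c, d correspond to
   hyperspheres through the five common points.

   If there are two such hyperplanes, a, b, c, d lie in a plane.  When w and v
   are parallel, e lies on the line ac, so the circle of the face 13, 23, 34
   passes through Phi_12, which is excluded.  Otherwise the lines ab and cd meet
   in a point p, with a - p = al w, c - p = ga v, and a second inversion at p
   sends a, b, c, d, e to w^-1 / al, w^-1 / (al - 1), v^-1 / ga, v^-1 / (ga + 1)
   and (w^-1 + v^-1) / (al + ga), Phi_12 to 0: the circles of the faces F1, ...,
   F4 become four lines of a plane, i.e. circles through P = infinity, and the
   configuration is classical. *)
Require Import Defs.
From mathcomp Require Import all_boot all_order all_algebra.
From mathcomp Require Import ring lra.
From mathcomp Require Import all_classical all_reals all_analysis.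

Set Implicit Arguments.
Unset Strict Implicit.
Unset Printing Implicit Defensive.

Import Order.TTheory GRing.Theory Num.Theory.
Local Open Scope classical_set_scope.
Local Open Scope ring_scope.

(** * Quaternion algebra and the Euclidean inner product *)

Section QuaternionAlgebra.
Variable R : realType.
Implicit Types (x y z : quaternion R) (k t : R).

Lemma qunitE x : (x \is a GRing.unit) = (x != 0).
Proof. by []. Qed.

Lemma qinvE x : x^-1 = (dot x x)^-1 *: qconj x.
Proof. by []. Qed.

Lemma quatN x : (re (- x) = - re x) * (imi (- x) = - imi x) *
  (imj (- x) = - imj x) * (imk (- x) = - imk x).
Proof. by rewrite -scaleN1r !quatZ !mulN1r. Qed.

Lemma quatM x y : x * y = qmul x y.
Proof. by []. Qed.

Lemma quat1 : (1 : quaternion R) = quat 1 0 0 0.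
Proof. by []. Qed.

Definition qE := (quatD, quatN, quatM, quatZ, quat1, quat0, quatE).

Lemma qscaleAl k x y : k *: (x * y) = (k *: x) * y.
Proof. by apply: quat_eqP; rewrite !qE; ring. Qed.

Lemma qscaleAr k x y : k *: (x * y) = x * (k *: y).
Proof. by apply: quat_eqP; rewrite !qE; ring. Qed.

Lemma qmulf_eq0 x y : (x * y == 0) = (x == 0) || (y == 0).
Proof.
have [->|x0] := eqVneq x 0; first by rewrite mul0r eqxx.
by apply/eqP/eqP => [xy0|->]; rewrite ?mulr0 // -(@mulKr _ x x0 y) xy0 mulr0.
Qed.

(** Polarised form of the multiplicativity of the norm. *)
Lemma dotM x y z : dot (x * y) (x * z) = dot x x * dot y z.
Proof. by rewrite !dotE !qE; ring. Qed.

Lemma dotMr x y z : dot (y * x) (z * x) = dot x x * dot y z.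
Proof. by rewrite !dotE !qE; ring. Qed.

Lemma dotDl x y z : dot (x + y) z = dot x z + dot y z.
Proof. by rewrite !dotE !qE; ring. Qed.

Lemma dotZl k x z : dot (k *: x) z = k * dot x z.
Proof. by rewrite !dotE !qE; ring. Qed.

Lemma dotC x y : dot x y = dot y x.
Proof. by rewrite !dotE; ring. Qed.

Lemma dotDr x y z : dot x (y + z) = dot x y + dot x z.
Proof. by rewrite dotC dotDl !(dotC x). Qed.

Lemma dotZr k x z : dot x (k *: z) = k * dot x z.
Proof. by rewrite dotC dotZl dotC. Qed.

Lemma dotNl x z : dot (- x) z = - dot x z.
Proof. by rewrite -scaleN1r dotZl mulN1r. Qed.

Lemma dotNr x z : dot x (- z) = - dot x z.
Proof. by rewrite dotC dotNl dotC. Qed.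

Lemma dot_ge0 x : 0 <= dot x x.
Proof. by rewrite dotE; nra. Qed.

Lemma dot_gt0 x : (0 < dot x x) = (x != 0).
Proof. by rewrite lt_def dot_ge0 andbT dot_eq0. Qed.

(** As [0^-1 = 0], both sides vanish when a factor does. *)
Lemma qinvM x y : (x * y)^-1 = y^-1 * x^-1.
Proof.
have [->|x0] := eqVneq x 0; first by rewrite invr0 mul0r mulr0 invr0.
have [->|y0] := eqVneq y 0; first by rewrite invr0 mul0r mulr0 invr0.
by rewrite invrM.
Qed.

Lemma qscale_inv k x : (k *: x)^-1 = k^-1 *: x^-1.
Proof.
have [->|k0] := eqVneq k 0; first by rewrite invr0 !scale0r invr0.
have [->|x0] := eqVneq x 0; first by rewrite scaler0 invr0 scaler0.
have kx0 : k *: x != 0 by rewrite scaler_eq0 negb_or k0.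
apply: (mulrI (x := k *: x)); first by [].
by rewrite mulrV // -qscaleAl -qscaleAr scalerA divff // scale1r mulrV.
Qed.

Lemma exists_unit x : x != 0 ->
  exists N u, [/\ 0 < N, dot u u = 1, x = N *: u & N ^+ 2 = dot x x].
Proof.
rewrite -dot_gt0 => x0; set N := Num.sqrt (dot x x).
have N0 : 0 < N by rewrite sqrtr_gt0.
have NN : N ^+ 2 = dot x x by rewrite sqr_sqrtr // ltW.
exists N, (N^-1 *: x); split => //.
- by rewrite dotZl dotZr -NN; field; lra.
- by rewrite scalerA divff ?scale1r //; lra.
Qed.

End QuaternionAlgebra.

(** * Circles under similarities and quaternion inversion *)

Section CirclePreservation.
Variable R : realType.
Implicit Types (x y m n k h : quaternion R) (s t : R).
Local Notation q1 := (1 : quaternion R).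

(** Inversion in the unit sphere followed by quaternion conjugation; in this form differences of
    images factor as products, see [sub_inv]. *)
Definition einv (z : epoint R) : epoint R :=
  match z with
  | None => Some 0
  | Some x => if x == 0 then None else Some x^-1
  end.

Definition eshift k : epoint R -> epoint R := omap (fun x => x + k).

Lemma einvK : involutive einv.
Proof.
case=> [x|] /=; last by rewrite eqxx.
have [->//|x0] := eqVneq x 0.
by rewrite /= -[_ == 0]negbK -qunitE unitrV qunitE x0 invrK.
Qed.

Lemma eshiftK k : cancel (eshift k) (eshift (- k)).
Proof. by case=> //= x; rewrite addrK. Qed.

(** For nonzero [m] and [n] this is a similarity. *)
Definition eaff m n k : epoint R -> epoint R := omap (fun y => m * y * n + k).

(** The model line of which all circles are images: a parallel to the real axis. *)
Definition eline h (t : option R) : epoint R := omap (fun s => s *: q1 + h) t.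

Lemma unit_circle (a b : R) :
  a ^+ 2 + b ^+ 2 = 1 -> exists t, a = cos t /\ b = sin t.
Proof.
move=> ab1; have aI : -1 <= a <= 1 by nra.
have [b0|b0] := leP 0 b.
  exists (acos a); rewrite acosK ?sin_acos //; split=> //.
  have -> : 1 - a ^+ 2 = b ^+ 2 by lra.
  by rewrite sqrtr_sqr ger0_norm.
exists (- acos a); rewrite cosN sinN acosK ?sin_acos //; split=> //.
have -> : 1 - a ^+ 2 = b ^+ 2 by lra.
by rewrite sqrtr_sqr ltr0_norm // opprK.
Qed.

(* Stereographic parameter; [None] is the pole [c + r v]. *)
Definition rat_param (c u v : quaternion R) (r : R) (t : option R) : epoint R :=
  match t with
  | None => Some (c + r *: v)
  | Some s => Some (c + (r * (2 * s / (s ^+ 2 + 1))) *: u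
                      + (r * ((s ^+ 2 - 1) / (s ^+ 2 + 1))) *: v)
  end.

Lemma carrier_rat_param (c u v : quaternion R) (r : R) :
  carrier (OCircle c u v r) = range (rat_param c u v r).
Proof.
apply/seteqP; split=> [_ [t _ <-]|_ [[s|] _ <-]] /=.
- have := cos2Dsin2 t; set a := cos t; set b := sin t => ab1.
  have [b1|b1] := eqVneq b 1.
    have a0 : a = 0 by nra.
    by exists None => //=; rewrite a0 b1 mulr0 scale0r addr0 mulr1.
  have b1' : 1 - b != 0 by rewrite subr_eq0 eq_sym.
  (* Stereographic projection from the pole [(0, 1)] sends [(a, b)] to [a / (1 - b)]. *)
  have sE : (a / (1 - b)) ^+ 2 + 1 = 2 / (1 - b).
    have -> : (a / (1 - b)) ^+ 2 = a ^+ 2 / (1 - b) ^+ 2 by field.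
    have -> : a ^+ 2 = 1 - b ^+ 2 by lra.
    by field.
  have sE' : (a / (1 - b)) ^+ 2 - 1 = 2 * b / (1 - b).
    by rewrite -[_ - 1](addrK 2) -addrA -addrA (_ : -1 + (2 - 2) = 1 - 2);
       [rewrite addrA sE; field | ring].
  exists (Some (a / (1 - b))) => //=; rewrite sE sE'; congr (Some (_ + _ *: _ + _ *: _)).
    by congr (_ * _); field.
  by congr (_ * _); field.
- have d0 : s ^+ 2 + 1 != 0 by apply: lt0r_neq0; nra.
  have [|t [ct st]] := @unit_circle (2 * s / (s ^+ 2 + 1)) ((s ^+ 2 - 1) / (s ^+ 2 + 1)).
    by field.
  by exists t => //; rewrite -ct -st.
- by exists (pi / 2) => //; rewrite cos_pihalf sin_pihalf mulr0 scale0r addr0 mulr1.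
Qed.

Lemma carrier_OLine (p u : quaternion R) :
  carrier (OLine p u) = None |` [set Some (p + t *: u) | t in [set: R]].
Proof. by []. Qed.

(* In this form the image of a circle under inversion is computed by
   [einv_eaff_einv]. *)
Definition mobius_circle (X : set (epoint R)) : Prop :=
  exists m n k h, [/\ m != 0, n != 0 & X = range (eaff m n k \o einv \o eline h)].

Lemma re_im_neq0 s (i : quaternion R) :
  re i = 0 -> i != 0 -> s *: q1 + i != 0.
Proof.
move=> i_re; apply: contraNneq => si0.
have s0 : s = 0 by move/(congr1 (@re R)): si0; rewrite !qE i_re mulr1 addr0.
by move: si0; rewrite s0 scale0r add0r => ->.
Qed.

Lemma qinv_re_im s (i : quaternion R) : re i = 0 ->
  (s *: q1 + i)^-1 = (s ^+ 2 + dot i i)^-1 *: (s *: q1 - i).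
Proof.
move=> i_re; rewrite qinvE; congr (_^-1 *: _).
  by rewrite !dotE !qE i_re; ring.
by apply: quat_eqP; rewrite /qconj !qE ?i_re; ring.
Qed.

(** With the imaginary unit [i = v * u^-1], the stereographic parametrisation of a circle is
    [c + r v + 2 r (s + i)^-1 u]. A line is the case [h = 0], with its parameter inverted. *)
Lemma is_circle_mobius X : is_circle X -> mobius_circle X.
Proof.
case=> -[c u v r|p u] /= ok <-.
- case: ok => -[u1 v1 uv] r0.
  have u0 : u != 0 by rewrite -dot_gt0 u1.
  have rei : re (v * u^-1) = 0.
    rewrite qinvE u1 invr1 scale1r quatM /qconj !quatE !(mulrN, opprK).
    by rewrite -uv dotE; ring.
  have i1 : dot (v * u^-1) (v * u^-1) = 1.
    by rewrite -[LHS]mul1r -u1 -dotMr mulrVK // u1.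
  exists ((2 * r) *: q1), u, (c + r *: v), (v * u^-1); split=> //.
    by rewrite scaler_eq0 negb_or oner_eq0 andbT; lra.
  rewrite -[LHS]/(carrier (OCircle c u v r)) carrier_rat_param.
  apply: eq_imagel => -[s|] _ /=; last by rewrite mulr0 mul0r add0r.
  have i0 : v / u != 0 by rewrite -dot_gt0 i1.
  rewrite (negbTE (re_im_neq0 s rei i0)) /=.
  have -> : (2 * r) *: q1 * (s *: q1 + v / u)^-1 * u =
      (2 * r / (s ^+ 2 + 1)) *: (s *: u - v).
    rewrite qinv_re_im // i1 -qscaleAr -!qscaleAl mul1r scalerA mulrBl -qscaleAl mul1r.
    by rewrite mulrVK // mulrC.
  have d0 : s ^+ 2 + 1 != 0 by apply: lt0r_neq0; nra.
  congr Some; apply: quat_eqP; rewrite !qE; field => //.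
- exists u, 1, p, 0; split; rewrite ?oner_neq0 //.
    by rewrite -dot_gt0 ok.
  apply/seteqP; split=> [z [->|[t _ <-]]|z [[t|] _ <-]] /=.
  + by exists (Some 0) => //=; rewrite scale0r addr0 eqxx.
  + have [->|t0] := eqVneq t 0.
      by exists None => //=; rewrite scale0r mulr0 mul0r add0r addr0.
    exists (Some t^-1) => //=.
    rewrite addr0 scaler_eq0 invr_eq0 (negbTE t0) oner_eq0 /= qscale_inv !invrK invr1.
    by rewrite -qscaleAr !mulr1 addrC.
  + rewrite addr0 scaler_eq0 oner_eq0 orbF.
    have [_|t0] := eqVneq t 0; first by left.
    right; exists t^-1 => //=.
    by rewrite qscale_inv invr1 -qscaleAr !mulr1 addrC.
  + by right; exists 0 => //; rewrite scale0r mulr0 mul0r add0r addr0.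
Qed.

Lemma mobius_is_circle X : mobius_circle X -> is_circle X.
Proof.
case=> m [n [k [h [m0 n0 ->]]]].
(* The real part of [h] only shifts the parameter; the image is a line or a proper circle according
   to whether the imaginary part [i] vanishes. *)
pose s0 := re h; pose i : quaternion R := h - s0 *: q1.
have i_re : re i = 0 by rewrite /i /s0 !qE; ring.
have mn0 : m * n != 0 by rewrite qmulf_eq0 negb_or m0.
have [N [u [N0 u1 mnE NN]]] := exists_unit mn0.
have hE t : t *: q1 + h = (t + s0) *: q1 + i.
  by rewrite /i scalerDl -addrA [s0 *: _ + _]addrC subrK.
have [i0|i0] := eqVneq i 0.
  have hE' t : t *: q1 + h = (t + s0) *: q1.
    by rewrite hE i0 addr0.
  exists (OLine k u) => //=.
  apply/seteqP; split=> [z [->|[t _ <-]]|z [[t|] _ <-]] /=.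
  + by exists (Some (- s0)) => //=; rewrite hE' addNr scale0r eqxx.
  + have [->|t0] := eqVneq t 0.
      by exists None => //=; rewrite scale0r mulr0 mul0r add0r addr0.
    exists (Some (N / t - s0)) => //=.
    rewrite hE' subrK scaler_eq0 mulf_eq0 invr_eq0 (negbTE t0) (gt_eqF N0) oner_eq0 /=.
    rewrite qscale_inv invr1 -qscaleAr mulr1 -qscaleAl mnE scalerA addrC.
    by congr (Some (_ + _ *: _)); field; rewrite t0 gt_eqF.
  + rewrite hE' scaler_eq0 oner_eq0 orbF.
    have [_|t0] := eqVneq (t + s0) 0; first by left.
    right; exists (N / (t + s0)) => //=.
    rewrite qscale_inv invr1 -qscaleAr mulr1 -qscaleAl mnE scalerA addrC.
    by congr (Some (_ *: _ + _)); field.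
  + by right; exists 0 => //; rewrite scale0r mulr0 mul0r add0r addr0.
have [P [j [P0 j1 iE PP]]] := exists_unit i0.
pose v : quaternion R := N^-1 *: (m * j * n).
have j_re : re j = 0.
  by apply/eqP; move/eqP: i_re; rewrite iE quatZ mulf_eq0 (gt_eqF P0).
have uE : u = N^-1 *: (m * n) by rewrite mnE scalerA mulVf ?scale1r ?gt_eqF.
have NN' : N ^+ 2 = dot m m * dot n n.
  by rewrite NN dotM.
(* The line [eline h] has distance [P] from 0, so its inverse has diameter [1 / P], scaled by
   [N = |m * n|]. The image of infinity is [k], which becomes the stereographic pole. *)
exists (OCircle (k - (N / (2 * P)) *: v) u v (N / (2 * P))).
  split; last by rewrite divr_gt0 // mulr_gt0.
  split=> //.
    rewrite /v dotZl dotZr dotMr dotM j1 mulr1 [dot n n * _]mulrC -NN'.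
    by field; rewrite gt_eqF.
  rewrite uE /v dotZl dotZr dotMr.
  have -> : dot m (m * j) = dot m m * dot 1 j by rewrite -dotM mulr1.
  by rewrite [dot 1 j]dotE j_re !qE; ring.
rewrite carrier_rat_param.
have hE' t : t *: q1 + h = P *: (((t + s0) / P) *: q1 + j).
  by rewrite hE scalerDr -iE scalerA mulrC divfK ?gt_eqF.
have nz s : s *: q1 + j != 0.
  by apply: re_im_neq0; rewrite // -dot_gt0 j1.
have jE s : (s *: q1 + j)^-1 = (s ^+ 2 + 1)^-1 *: (s *: q1 - j).
  by rewrite qinv_re_im // ?j1.
have vE s : m * (P *: (s *: q1 + j))^-1 * n + k =
  k - (N / (2 * P)) *: v + (N / (2 * P) * (2 * s / (s ^+ 2 + 1))) *: u
                      + (N / (2 * P) * ((s ^+ 2 - 1) / (s ^+ 2 + 1))) *: v.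
  have E : m * (s *: q1 - j) * n = s *: (m * n) - m * j * n.
    by rewrite mulrBr mulrBl -qscaleAr mulr1 -qscaleAl.
  rewrite qscale_inv jE -!qscaleAr -!qscaleAl E uE /v.
  have d0 : s ^+ 2 + 1 != 0 by apply: lt0r_neq0; nra.
  move: (m * n) (m * j * n) => A B; have P0' := lt0r_neq0 P0; have N0' := lt0r_neq0 N0.
  by apply: quat_eqP; rewrite !qE; field; rewrite d0 P0' N0'.
apply/seteqP; split=> [z [[s|] _ <-]|z [[t|] _ <-]] /=.
- exists (Some (P * s - s0)) => //=.
  rewrite hE' subrK mulrAC divff ?gt_eqF // mul1r scaler_eq0 (gt_eqF P0) (negbTE (nz _)) /=.
  by rewrite vE.
- by exists None => //=; rewrite subrK mulr0 mul0r add0r.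
- exists (Some ((t + s0) / P)) => //=.
  by rewrite hE' scaler_eq0 (gt_eqF P0) (negbTE (nz _)) /= vE.
- by exists None => //=; rewrite subrK mulr0 mul0r add0r.
Qed.

Lemma eaff_circle m n k X :
  m != 0 -> n != 0 -> is_circle X -> is_circle (eaff m n k @` X).
Proof.
move=> m0 n0 /is_circle_mobius[m' [n' [l [h [m'0 n'0 ->]]]]].
apply: mobius_is_circle; exists (m * m'), (n' * n), (m * l * n + k), h.
split; rewrite ?qmulf_eq0 ?negb_or ?m0 ?n0 ?m'0 ?n'0 //.
rewrite image_comp; apply: eq_imagel => t _ /=.
by case: (einv _) => //= x; rewrite !(mulrDl, mulrDr, mulrA) addrA.
Qed.

Lemma eshiftE k : eshift k = eaff 1 1 k.
Proof. by apply/funext => -[x|] //=; rewrite mul1r mulr1. Qed.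

Lemma eshift_circle k X : is_circle X -> is_circle (eshift k @` X).
Proof. by rewrite eshiftE; apply: eaff_circle; rewrite oner_neq0. Qed.

(* The scalar model is [1 / (1/y + k) = 1/k - (1/k) / (y + 1/k) / k]. *)
Lemma einv_eaff_einv m n k (z : epoint R) : m != 0 -> n != 0 -> k != 0 ->
  einv (eaff m n k (einv z)) =
  eaff (- (k^-1 * m)) (n * k^-1) k^-1 (einv (eshift (n * k^-1 * m) z)).
Proof.
move=> m0 n0 k0; case: z => [y|] /=; last first.
  by rewrite !(mulr0, mul0r, add0r) (negbTE k0).
have [->|y0] := eqVneq y 0.
  rewrite add0r qmulf_eq0 qmulf_eq0 invr_eq0 (negbTE m0) (negbTE n0) (negbTE k0) /=.
  congr Some; rewrite !qinvM invrK !mulrA mulNr mulrK // mulNr mulVr // mulN1r.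
  by rewrite mulNr mulVr // mulN1r addNr.
set K := n * k^-1 * m.
have K0 : K != 0.
  by rewrite !qmulf_eq0 !negb_or n0 m0 invr_eq0 k0.
(* The constant [K] is chosen so that [m * K^-1 * n = k]; this makes the sum a product, which can be
   inverted factor by factor. *)
have E : m * y^-1 * n + k = m * y^-1 * (y + K) * K^-1 * n.
  rewrite mulrDr mulrVK // !mulrDl mulrK // addrC; congr (_ + _).
  by rewrite /K !qinvM invrK !mulrA mulrV // mul1r mulrVK.
rewrite /= E !qmulf_eq0 !invr_eq0 (negbTE m0) (negbTE n0) (negbTE y0) (negbTE K0) orbF /=.
have [//|yK0] := eqVneq (y + K) 0.
congr Some; rewrite !qinvM !invrK.
have -> : y * m^-1 = (y + K) * m^-1 - K * m^-1 by rewrite mulrDl addrK.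
rewrite !mulrDr !mulrN mulKr // addrC /K !mulrA mulVr // mul1r mulrK //.
by rewrite mulrK // !mulNr -!mulrA.
Qed.

Lemma einv_circle X : is_circle X -> is_circle (einv @` X).
Proof.
move=> /is_circle_mobius[m [n [k [h [m0 n0 ->]]]]].
(* The parameter at infinity gives the point [k]. For [k = 0] the two inversions cancel up to a
   similarity, and the image is a line. *)
have [->|k0] := eqVneq k 0.
  have -> : einv @` range ((eaff m n 0 \o einv) \o eline h) =
            eaff n^-1 m^-1 0 @` carrier (OLine h q1).
    have -> : carrier (OLine h q1) = range (eline h).
      apply/seteqP; split=> [z [-> | [t _ <-]]|z [[t|] _ <-]] /=.
      + by exists None.
      + by exists (Some t) => //=; rewrite addrC.
      + by right; exists t => //; rewrite addrC.
      + by left.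
    rewrite !image_comp; apply: eq_imagel => t _ /=.
    case: (eline h t) => [y|] /=; last by rewrite mulr0 mul0r add0r eqxx.
    have [->|y0] := eqVneq y 0; first by rewrite /= mulr0 mul0r addr0.
    rewrite /= !addr0 !qmulf_eq0 invr_eq0 (negbTE m0) (negbTE n0) (negbTE y0) /=.
    by rewrite !qinvM invrK mulrA.
  apply: eaff_circle; rewrite ?invr_eq0 //.
  by exists (OLine h q1) => //; rewrite /= dotE !qE; ring.
apply: mobius_is_circle.
exists (- (k^-1 * m)), (n * k^-1), k^-1, (h + n * k^-1 * m).
split; rewrite ?oppr_eq0 ?qmulf_eq0 ?invr_eq0 ?negb_or ?k0 ?m0 ?n0 //.
rewrite image_comp; apply: eq_imagel => t _ /=.
by rewrite einv_eaff_einv //; case: t => //= s; rewrite addrA.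
Qed.
End CirclePreservation.

Arguments einv {R}.

(** * Lines as circles through infinity, and linear coordinates in a plane *)

Section Lines.
Variable R : realType.
Implicit Types (x y z : quaternion R) (s t : R) (X : set (epoint R)).

Definition line_through x y : set (epoint R) :=
  None |` [set Some (x + t *: (y - x)) | t in [set: R]].

(** A proper circle is bounded and lies on a sphere, which a line meets in at most two points. So
    infinity or a third collinear point on [X] rules out a proper circle. *)
Lemma circle_line X x y : is_circle X -> x != y -> X (Some x) -> X (Some y) ->
  (X None \/ exists t, [/\ t != 0, t != 1 & X (Some (x + t *: (y - x)))]) ->
  X = line_through x y.
Proof.
case=> -[c u v r|p u] ok <- xy; last first.
  case=> // -[a _ [xE]] [//|[b _ [yE]]] _.
  have ab : b - a != 0.
    by rewrite subr_eq0; apply: contraNneq xy => ba; rewrite -xE -yE ba.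
  have yxE : y - x = (b - a) *: u.
    by rewrite -xE -yE scalerBl opprD addrACA subrr add0r.
  rewrite /line_through yxE -xE carrier_OLine; congr (_ `|` _).
  apply/seteqP; split=> _ [t _ <-].
    exists ((t - a) / (b - a)) => //; congr Some.
    by rewrite scalerA divfK // -addrA -scalerDl [a + _]addrC subrK.
  exists (a + t * (b - a)) => //; congr Some.
  by rewrite scalerA -addrA -scalerDl.
case: ok => -[u1 v1 uv] r0 Xx Xy.
have on_sphere z : carrier (OCircle c u v r) (Some z) -> dot (z - c) (z - c) = r ^+ 2.
  case=> t _ [<-]; rewrite addrAC [c + _]addrC addrK.
  rewrite !(dotDl, dotDr, dotZl, dotZr) u1 v1 [dot v u]dotC uv.
  have -> : r ^+ 2 = r ^+ 2 * (cos t ^+ 2 + sin t ^+ 2) by rewrite cos2Dsin2 mulr1.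
  by ring.
case=> [[t _ //]|[t [t0 t1 /on_sphere hz]]].
move/on_sphere: Xx => hx; move/on_sphere: Xy => hy.
(* Along the line through [x] and [y], the squared distance to [c] minus [r ^+ 2] is a quadratic
   polynomial in the parameter with roots 0 and 1. *)
have : t * (t - 1) * dot (y - x) (y - x) = 0.
  have E : y - x = (y - c) - (x - c) by rewrite opprB addrA subrK.
  move: hx hy hz; rewrite addrAC E; move: (x - c) (y - c) => p q hp hq.
  rewrite !(dotDl, dotDr, dotNl, dotNr, dotZl, dotZr) hp hq [dot q p]dotC; lra.
move/eqP; rewrite !mulf_eq0 (negbTE t0) subr_eq0 (negbTE t1) dot_eq0 subr_eq0.
by rewrite eq_sym (negbTE xy).
Qed.

Definition independent2 (W V : quaternion R) : Prop :=
  forall s t, s *: W + t *: V = 0 -> s = 0 /\ t = 0.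

Lemma independent2_inj (W V : quaternion R) s t s' t' : independent2 W V ->
  s *: W + t *: V = s' *: W + t' *: V -> s = s' /\ t = t'.
Proof.
move=> WV /eqP; rewrite -subr_eq0 opprD addrACA -!scalerBl => /eqP/WV[].
by move=> /eqP + /eqP; rewrite !subr_eq0 => /eqP -> /eqP ->.
Qed.

Lemma plane_line_param (i j k s1 t1 s2 t2 s3 t3 : R) : (i != 0) || (j != 0) ->
  i * s1 + j * t1 = k -> i * s2 + j * t2 = k -> i * s3 + j * t3 = k ->
  (s1 != s2) || (t1 != t2) ->
  exists r, s3 = s1 + r * (s2 - s1) /\ t3 = t1 + r * (t2 - t1).
Proof.
move=> ij h1 h2 h3 h12.
have [s12|s12] := eqVneq s1 s2.
  move: h12; rewrite s12 eqxx /= => t12.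
  have i0 : i != 0.
    have [j0|j0] := eqVneq j 0; first by move: ij; rewrite j0 eqxx orbF.
    have : j * (t1 - t2) = 0 by rewrite -s12 in h2; lra.
    by move/eqP; rewrite mulf_eq0 (negbTE j0) subr_eq0 (negbTE t12).
  have j0 : j = 0.
    have : j * (t1 - t2) = 0 by rewrite -s12 in h2; lra.
    by move/eqP; rewrite mulf_eq0 [t1 - _ == 0]subr_eq0 (negbTE t12) orbF => /eqP.
  have t21 : t2 - t1 != 0 by rewrite subr_eq0 eq_sym.
  exists ((t3 - t1) / (t2 - t1)); split; last by field.
  rewrite subrr mulr0 addr0; apply: (mulfI i0).
  by move: h2 h3; rewrite j0 !mul0r !addr0 => -> ->.
have s21 : s2 - s1 != 0 by rewrite subr_eq0 eq_sym.
have j0 : j != 0.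
  apply: contraNneq s12 => j0; move: ij; rewrite j0 eqxx orbF => i0.
  by apply/eqP/(mulfI i0); move: h1 h2; rewrite j0 !mul0r !addr0 => -> ->.
exists ((s3 - s1) / (s2 - s1)); split; first by field.
apply: (mulfI j0); have -> : j * t3 = k - i * s3 by lra.
have -> : j * (t1 + (s3 - s1) / (s2 - s1) * (t2 - t1)) =
  j * t1 + (s3 - s1) / (s2 - s1) * (j * t2 - j * t1) by ring.
have -> : j * t2 = k - i * s2 by lra.
have -> : j * t1 = k - i * s1 by lra.
by field.
Qed.

(** Here [i], [j], [k] are coefficients of a linear equation in oblique coordinates, not quaternion
    units. *)
Definition plane_line (W V : quaternion R) (i j k : R) : set (epoint R) :=
  None |` [set Some (st.1 *: W + st.2 *: V) |
            st in [set st : R * R | i * st.1 + j * st.2 = k]].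

Lemma circle_plane_line W V i j k X (s1 t1 s2 t2 s3 t3 : R) :
  is_circle X -> independent2 W V -> (i != 0) || (j != 0) ->
  let pt s t := s *: W + t *: V in
  X (Some (pt s1 t1)) -> X (Some (pt s2 t2)) -> X (Some (pt s3 t3)) ->
  pt s1 t1 != pt s2 t2 -> pt s1 t1 != pt s3 t3 -> pt s2 t2 != pt s3 t3 ->
  i * s1 + j * t1 = k -> i * s2 + j * t2 = k -> i * s3 + j * t3 = k ->
  X = plane_line W V i j k.
Proof.
move=> cX WV ij pt X1 X2 X3 n12 n13 n23 h1 h2 h3.
have st12 : (s1 != s2) || (t1 != t2).
  by rewrite -negb_and; apply: contra n12 => /andP[/eqP -> /eqP ->].
have ptE r : pt (s1 + r * (s2 - s1)) (t1 + r * (t2 - t1)) =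
    pt s1 t1 + r *: (pt s2 t2 - pt s1 t1).
  by apply: quat_eqP; rewrite /pt !qE; ring.
have -> : X = line_through (pt s1 t1) (pt s2 t2).
  apply: circle_line => //; right.
  have [r [s3E t3E]] := plane_line_param ij h1 h2 h3 st12.
  move: X3 n13 n23; rewrite s3E t3E ptE => X3 n13 n23; exists r; split=> //.
    by apply: contraNneq n13 => ->; rewrite scale0r addr0.
  by apply: contraNneq n23 => ->; rewrite scale1r addrC subrK.
congr (_ `|` _); apply/seteqP; split=> [_ [r _ <-]|_ [[s t] /= h <-]].
  exists (s1 + r * (s2 - s1), t1 + r * (t2 - t1)) => /=; last by rewrite -ptE.
  have -> : i * (s1 + r * (s2 - s1)) + j * (t1 + r * (t2 - t1)) =
      (1 - r) * (i * s1 + j * t1) + r * (i * s2 + j * t2) by ring.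
  by rewrite h1 h2; ring.
have [r [-> ->]] := plane_line_param ij h1 h2 h st12.
by exists r => //; rewrite -ptE.
Qed.

Lemma plane_lineI W V (i j k i' j' k' s t : R) : independent2 W V ->
  i * j' - i' * j != 0 -> i * s + j * t = k -> i' * s + j' * t = k' ->
  plane_line W V i j k `&` plane_line W V i' j' k' =
  [set None; Some (s *: W + t *: V)].
Proof.
move=> WV d h h'; apply/seteqP; split=> [z [[->|]]|z [->|->]] /=.
- by left.
- case=> -[s1 t1] /= h1 <- [//|[[s2 t2] /= h2 [e]]].
  have [s12 t12] := independent2_inj WV e; move: h2; rewrite s12 t12 => h2.
  (* Cramer's rule: both coordinates are determined after multiplication by [i * j' - i' * j]. *)
  right; congr (Some (_ *: _ + _ *: _)); apply: (mulfI d); subst k k'.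
    transitivity (j' * (i * s1 + j * t1) - j * (i' * s1 + j' * t1)); first ring.
    by rewrite h1 h2; ring.
  transitivity (i * (i' * s1 + j' * t1) - i' * (i * s1 + j * t1)); first ring.
  by rewrite h1 h2; ring.
- by split; left.
- by split; right; exists (s, t).
Qed.

(** Gram-Schmidt; it supplies the orthonormal frame that [classical_clifford] asks for. *)
Lemma independent2_orthonormal W V : independent2 W V ->
  exists u v, [/\ orthonormal2 u v, exists a, W = a *: u &
    exists b c, V = b *: u + c *: v].
Proof.
move=> WV; have W0 : W != 0.
  apply/eqP => W0; have [] := WV 1 0; first by rewrite W0 scaler0 scale0r addr0.
  by move/eqP; rewrite oner_eq0.
have [N [u [N0 u1 WE _]]] := exists_unit W0.
have V0 : V - dot u V *: u != 0.
  apply/eqP => V0; have [|_] := WV (- (dot u V / N)) 1; last by move/eqP; rewrite oner_eq0.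
  by rewrite WE scale1r scalerA mulNr divfK ?gt_eqF // scaleNr addrC.
have [N' [v [N'0 v1 VE _]]] := exists_unit V0.
exists u, v; split; [split=> // | by exists N | ].
  have : dot u (V - dot u V *: u) = 0 by rewrite dotDr dotNr dotZr u1; ring.
  by rewrite VE dotZr => /eqP; rewrite mulf_eq0 (gt_eqF N'0) => /eqP.
by exists (dot u V), N'; rewrite -VE addrC subrK.
Qed.

End Lines.

(** * Quaternion inversion as a conformal map *)

Section Conformal.
Variable R : realType.

(** Quaternion conjugation is the orthogonal map with matrix diag(1, -1, -1, -1). *)
Lemma conformal_einv : conformal (@einv R).
Proof.
pose d : quaternion R := quat 1 (-1) (-1) (-1).
have -> : @einv R = omap (fun x : quaternion R => x *m diag_mx d : quaternion R) \o
                    inversion (Sphere 0 1).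
  apply/funext => -[x|] /=; last by rewrite mul0mx.
  have [//|x0] := eqVneq x 0; congr Some.
  rewrite subr0 add0r expr1n div1r qinvE -scalemxAl; congr (_ *: _).
  rewrite mul_mx_diag; apply: quat_eqP; rewrite /qconj !quatE.
  - by rewrite [RHS]/re mxE -/(re x) -/(re d) quatE mulr1.
  - by rewrite [RHS]/imi mxE -/(imi x) -/(imi d) quatE mulrN1.
  - by rewrite [RHS]/imj mxE -/(imj x) -/(imj d) quatE mulrN1.
  - by rewrite [RHS]/imk mxE -/(imk x) -/(imk d) quatE mulrN1.
apply: conformal_comp; last by apply: conformal_inversion => /=.
apply: conformal_orthogonal; rewrite tr_diag_mx mulmx_diag -diag_const_mx.
congr diag_mx; apply: (@quat_eqP R).
all: rewrite /re /imi /imj /imk !mxE inordK //=; ring.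
Qed.

Lemma conformal_eshift (k : quaternion R) : conformal (eshift k).
Proof. exact: conformal_translation. Qed.

End Conformal.

(** * Coplanar images force a classical configuration *)

Section Classical.
Variable R : realType.
Implicit Types (s t : R) (X : set (epoint R)).

Lemma star_face_vertices f : star_face f -> exists v1 v2 v3,
  [/\ contains f v1, contains f v2, contains f v3 & [/\ v1 <> v2, v1 <> v3 & v2 <> v3]].
Proof.
case: f => // _; [exists V12, V13, V14 | exists V12, V23, V24
                 | exists V13, V23, V34 | exists V14, V24, V34]; by split.
Qed.

(** On each of the circles [F1], ..., [F4] the three given points are collinear, so these circles
    are four lines of the plane of [W] and [V], pairwise not parallel; infinity serves as [P]. *)
Lemma plane_lines_classical (T : face -> set (epoint R))
    (Q : vertex -> quaternion R) (W V : quaternion R) (al ga : R) :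
  (forall f, is_circle (T f)) ->
  (forall f v, contains f v -> T f (Some (Q v))) -> injective Q ->
  independent2 W V ->
  al != 0 -> al - 1 != 0 -> ga != 0 -> ga + 1 != 0 -> al + ga != 0 ->
  Q V12 = 0 -> Q V13 = al^-1 *: W -> Q V14 = (al - 1)^-1 *: W ->
  Q V23 = ga^-1 *: V -> Q V24 = (ga + 1)^-1 *: V ->
  Q V34 = (al + ga)^-1 *: (W + V) ->
  classical_clifford (fun v => Some (Q v)) T.
Proof.
move=> cT TQ Qinj WV al0 al1 ga0 ga1 alga Q12 Q13 Q14 Q23 Q24 Q34.
(* In the basis [W], [V] the four lines are [t = 0], [s = 0], [al s + ga t = 1] and
   [(al - 1) s + (ga + 1) t = 1]. *)
pose I f : R := match f with F1 => 0 | F2 => 1 | F3 => al | _ => al - 1 end.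
pose J f : R := match f with F1 => 1 | F2 => 0 | F3 => ga | _ => ga + 1 end.
pose K f : R := match f with F1 => 0 | F2 => 0 | _ => 1 end.
pose s v : R := match v with V12 => 0 | V13 => al^-1 | V14 => (al - 1)^-1
                        | V23 => 0 | V24 => 0 | V34 => (al + ga)^-1 end.
pose t v : R := match v with V12 => 0 | V13 => 0 | V14 => 0
                 | V23 => ga^-1 | V24 => (ga + 1)^-1 | V34 => (al + ga)^-1 end.
have QE v : Q v = s v *: W + t v *: V.
  by case: v; rewrite ?Q12 ?Q13 ?Q14 ?Q23 ?Q24 ?Q34 /= ?scale0r ?addr0 ?add0r ?scalerDr.
have inc f v : star_face f -> contains f v -> I f * s v + J f * t v = K f.
  by case: f; case: v => //= _ _; field; rewrite ?alga ?al1 ?ga1.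
have IJ f : (I f != 0) || (J f != 0).
  by case: f => /=; rewrite ?oner_eq0 ?al0 ?al1 ?orbT.
have TE f : star_face f -> T f = plane_line W V (I f) (J f) (K f).
  move=> sf; have [v1 [v2 [v3 [f1 f2 f3 [n12 n13 n23]]]]] := star_face_vertices sf.
  apply: (@circle_plane_line _ _ _ _ _ _ _ (s v1) (t v1) (s v2) (t v2) (s v3) (t v3)) => //.
  all: rewrite -?QE; try exact: TQ; try exact: inc.
  - by apply/eqP => /Qinj.
  - by apply/eqP => /Qinj.
  - by apply/eqP => /Qinj.
have [u [v [uv [a WE] [b [c VE]]]]] := independent2_orthonormal WV.
exists 0, u, v, None; split => //.
- split=> // f sf; rewrite TE //= => z [->|[[x y] _ <-]]; first by left.
  right; exists (x * a + y * b, y * c) => //=; congr Some.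
  by apply: quat_eqP; rewrite WE VE !qE; ring.
- by split=> // x y [] /Qinj.
- move=> f g w sf sg fg fw gw; rewrite !TE // QE; apply: plane_lineI => //; try exact: inc.
  (* Up to sign the determinants of pairs of lines are 1, [al], [al - 1], [ga], [ga + 1] and, for
     [F3] and [F4], [al + ga]. *)
  case: f g sf sg fg {fw gw} => -[] //= _ _ _.
  all: rewrite ?mul0r ?mulr0 ?mul1r ?mulr1 ?subr0 ?sub0r ?oppr_eq0 ?oner_eq0 //.
  + by apply: contraNneq alga => h; apply/eqP; lra.
  + by apply: contraNneq alga => h; apply/eqP; lra.
- by move=> f w _ fw; exact: TQ.
Qed.

Lemma affine_fixpoint (a c e : quaternion R) t : 1 + t != 0 ->
  e - a = t *: (c - e) -> e = a + (t / (1 + t)) *: (c - a).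
Proof.
move=> t1 ea; apply: (scalerI t1).
rewrite scalerDr scalerA mulrCA divff // mulr1 !scalerDl !scale1r scalerBr.
rewrite -addrA [t *: a + _]addrC subrK.
by apply/(addIr (- a)); rewrite addrAC ea scalerBr subrK addrAC subrr add0r.
Qed.

(** Multiplying a relation between [w^-1] and [v^-1] by [w] on the left and [v] on the right gives
    one between [v] and [w]. *)
Lemma independent2_inv (w v : quaternion R) : w != 0 -> v != 0 ->
  independent2 w v -> independent2 w^-1 v^-1.
Proof.
move=> w0 v0 wv s t st; have [|-> ->//] := wv t s.
have E : w * (s *: w^-1) * v + w * (t *: v^-1) * v = 0.
  by rewrite -mulrDl -mulrDr st mulr0 mul0r.
move: E; rewrite -(qscaleAr s) -(qscaleAr t) mulrV // -!qscaleAl mul1r mulrVK //.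
by rewrite addrC.
Qed.

(** With [p] as origin the term in [c] becomes [ga *: w], and the terms in [e - p] collect on the
    left. Inverting then makes [(e - p)^-1] a multiple of [w^-1 + v^-1]. *)
Lemma multiratio_point (a c e p v w : quaternion R) (al ga : R) : v != 0 ->
  a - p = al *: w -> c - p = ga *: v -> e - a = (c - e) * (v^-1 * w) ->
  (e - p) * (1 + v^-1 * w) = (al + ga) *: w.
Proof.
move=> v0 aE cE eqe.
have H : (e - p) - al *: w = (ga *: v - (e - p)) * (v^-1 * w).
  rewrite -aE -cE (_ : e - p - (a - p) = e - a); last by rewrite opprB addrA subrK.
  by rewrite eqe (_ : c - p - (e - p) = c - e) // opprB addrA subrK.
rewrite mulrBl -qscaleAl mulVKr // in H.
rewrite mulrDr mulr1 scalerDl -[X in X + _](subrK (al *: w)) H.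
by rewrite addrAC subrK addrC.
Qed.

Lemma multiratio_coplanar_classical (Phi : vertex -> quaternion R)
    (S : face -> ocircle R) :
  let y v := (Phi v - Phi V12)^-1 in
  let w := y V13 - y V14 in let v := y V24 - y V23 in
  octahedral Phi S ->
  y V34 - y V13 = (y V23 - y V34) * (v^-1 * w) ->
  (exists t, w = t *: v) \/
  (independent2 w v /\ exists s t, y V23 - y V13 = s *: v + t *: w) ->
  conformally_classical Phi S.
Proof.
move=> y w v [Phi_inj okS incS] eqe dep.
pose phi1 : epoint R -> epoint R := einv \o eshift (- Phi V12).
have phi1K : cancel phi1 (eshift (Phi V12) \o einv).
  by move=> z; rewrite /phi1 /= einvK -{1}[Phi V12]opprK eshiftK.
pose X f := phi1 @` carrier (S f).
have Xphi f z : X f (phi1 (Some (Phi z))) <-> contains f z.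
  rewrite -incS; split=> [[z' Sz' /(can_inj phi1K) <-]//|]; by exists (Some (Phi z)).
have cX f : is_circle (X f).
  rewrite /X /phi1 -image_comp; apply/einv_circle/eshift_circle.
  by exists (S f).
have phi1N : phi1 (Some (Phi V12)) = None by rewrite /phi1 /= subrr eqxx.
have phi1E z : z <> V12 -> phi1 (Some (Phi z)) = Some (y z).
  move=> z12; rewrite /phi1 /= subr_eq0; case: eqVneq => // /Phi_inj //.
have y_inj z z' : z <> V12 -> z' <> V12 -> z <> z' -> y z != y z'.
  move=> z12 z'12 zz'; apply/eqP => E; apply/zz'/Phi_inj.
  by have /(can_inj phi1K)[] : phi1 (Some (Phi z)) = phi1 (Some (Phi z')); rewrite ?phi1E ?E.
have XN f : X f None <-> contains f V12 by rewrite -Xphi phi1N.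
have Xy f z : z <> V12 -> X f (Some (y z)) <-> contains f z.
  by move=> z12; rewrite -Xphi phi1E.
set a := y V13 in w eqe dep *; set b := y V14 in w eqe dep *.
set c := y V23 in v eqe dep *; set d := y V24 in v eqe dep *.
set e := y V34 in eqe dep *.
have v0 : v != 0 by rewrite subr_eq0; exact: y_inj.
have w0 : w != 0 by rewrite subr_eq0; exact: y_inj.
case: dep => [[t wt]|[wv [s [t acE]]]].
  exfalso; move: eqe; rewrite wt -qscaleAr mulVr // -qscaleAr mulr1 => eqe.
  (* For [t = -1] the equation would read [e - a = e - c]. *)
  have t1 : 1 + t != 0.
    apply/negP => /eqP t1; have tE : t = -1 by lra.
    move: eqe; rewrite tE scaleN1r opprB => /addrI/oppr_inj/eqP.
    by apply/negP/y_inj.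
  have eE := affine_fixpoint t1 eqe.
  have /XN // : X F3 None.
  rewrite (@circle_line _ (X F3) a c) //; first by left.
  - exact: y_inj.
  - exact/Xy.
  - exact/Xy.
  right; exists (t / (1 + t)); rewrite -eE; split; last exact/Xy.
    by apply/negP => /eqP h; have := y_inj V34 V13; rewrite -/e -/a eE h scale0r addr0 eqxx
      => /(_ _ _ _)/negP; apply.
  by apply/negP => /eqP h; have := y_inj V34 V23; rewrite -/e -/c eE h scale1r addrC subrK eqxx
      => /(_ _ _ _)/negP; apply.
(* By [acE], [a + t *: w = c - s *: v], which is the common point of the lines ab and cd. *)
pose p := a + t *: w; pose al := - t; pose ga := s.
have aE : a - p = al *: w by rewrite /p /al opprD addrA subrr add0r scaleNr.
have bE : b - p = (al - 1) *: w.
  by rewrite scalerBl scale1r -aE /w opprB [RHS]addrC addrA subrK.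
have cE : c - p = ga *: v.
  by rewrite /p opprD addrA acE addrK.
have dE : d - p = (ga + 1) *: v.
  by rewrite scalerDl scale1r -cE /v [RHS]addrC addrA subrK.
have X1p : X F1 (Some p).
  rewrite (@circle_line _ (X F1) a b) //; try exact/Xy; try by left; exact/XN.
  - by right; exists al => //; rewrite /p /w /al scaleNr -scalerN opprB.
  - exact: y_inj.
have X2p : X F2 (Some p).
  rewrite (@circle_line _ (X F2) c d) //; try exact/Xy; try by left; exact/XN.
  - by right; exists (- ga) => //; rewrite -/v scaleNr -cE opprB addrC subrK.
  - exact: y_inj.
(* The faces [F1] and [F2] share only the vertex 12, so [p], which is on both circles, is none of
   the other points. All the following scalars are nonzero for this reason. *)
have yp z : z <> V12 -> y z != p.
  move=> z12; apply/eqP => yzp.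
  have /Xy h1 : X F1 (Some (y z)) by rewrite yzp.
  have /Xy h2 : X F2 (Some (y z)) by rewrite yzp.
  by move: (h1 z12) (h2 z12); case: z z12 {yzp h1 h2}.
have al0 : al != 0.
  by apply: contraNneq (yp V13 _) => // h; rewrite -subr_eq0 aE h scale0r.
have al1 : al - 1 != 0.
  by apply: contraNneq (yp V14 _) => // h; rewrite -subr_eq0 bE h scale0r.
have ga0 : ga != 0.
  by apply: contraNneq (yp V23 _) => // h; rewrite -subr_eq0 cE h scale0r.
have ga1 : ga + 1 != 0.
  by apply: contraNneq (yp V24 _) => // h; rewrite -subr_eq0 dE h scale0r.
have eE := multiratio_point v0 aE cE eqe.
have q1 : 1 + v^-1 * w != 0.
  apply/negP => /eqP h; have [|/eqP] := wv 1 1.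
    rewrite !scale1r; have -> : w + v = v * (1 + v^-1 * w).
      by rewrite mulrDr mulr1 mulVKr // addrC.
    by rewrite h mulr0.
  by rewrite oner_eq0.
have alga : al + ga != 0.
  apply: contraNneq (yp V34 _) => // h; move/eqP: eE.
  by rewrite h scale0r qmulf_eq0 (negbTE q1) orbF subr_eq0.
pose phi2 : epoint R -> epoint R := einv \o eshift (- p).
have phi2K : cancel phi2 (eshift p \o einv).
  by move=> z; rewrite /phi2 /= einvK -{1}[p]opprK eshiftK.
pose g := phi2 \o phi1.
have g_inj : injective g by apply: inj_comp; apply: can_inj; eassumption.
(* The point at the vertex 12 goes to infinity under [phi1] and then to 0 under [phi2]. *)
pose Q z := if z is V12 then 0 else (y z - p)^-1.
have gQ z : g (Some (Phi z)) = Some (Q z).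
  rewrite /g /=; have [z12|z12] : z = V12 \/ z <> V12 by case: z; [left|right..].
    by rewrite z12 phi1N.
  rewrite phi1E // /phi2 /= subr_eq0 (negbTE (yp _ z12)); congr Some.
  by case: z z12.
exists (fun z => Some (Q z)), (fun f => g @` carrier (S f)), g; split=> //.
- apply: (@plane_lines_classical _ _ w^-1 v^-1 al ga) => //.
  + move=> f; rewrite /g -image_comp; rewrite /phi2 -image_comp.
    by apply/einv_circle/eshift_circle/cX.
  + by move=> f z fz; rewrite -gQ; exists (Some (Phi z)) => //; exact/incS.
  + by move=> z z' zz'; apply: Phi_inj;
    have /g_inj[] : g (Some (Phi z)) = g (Some (Phi z')) by rewrite !gQ zz'.
  + exact: independent2_inv.
  + by rewrite /Q aE qscale_inv.
  + by rewrite /Q bE qscale_inv.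
  + by rewrite /Q cE qscale_inv.
  + by rewrite /Q dE qscale_inv.
  + rewrite /Q; have -> : e - p = (al + ga) *: (w * (1 + v^-1 * w)^-1).
      by rewrite qscaleAl -eE mulrK.
    by rewrite qscale_inv qinvM invrK mulrDl mul1r mulrK.
- apply: conformal_comp; apply: conformal_comp; exact: conformal_eshift || exact: conformal_einv.
- by apply: eq_imagel => z _; rewrite gQ.
Qed.
End Classical.

(** * Multi-ratio equations with one point at infinity, and the reflections exchanging them *)

Section Multiratio.
Variable R : realType.
Implicit Types (x y z n m : quaternion R) (s t k : R).

(** Noncommutative form of [1/y - 1/x = (x - y)/(x y)]. With [sub_inv_swap] the order of the outer
    factors can be chosen so that neighbours in a multi-ratio cancel. *)
Lemma sub_inv x y : x != 0 -> y != 0 -> x - y = x * (y^-1 - x^-1) * y.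
Proof. by move=> x0 y0; rewrite mulrBr mulrBl mulrVK // mulrV // mul1r. Qed.

Lemma sub_inv_swap x y : x != 0 -> y != 0 -> x - y = y * (y^-1 - x^-1) * x.
Proof. by move=> x0 y0; rewrite mulrBr mulrBl mulrVK // mulrV // mul1r. Qed.

Lemma conj_eq1 x y : x != 0 -> x * y * x^-1 = 1 -> y = 1.
Proof.
move=> x0 E; rewrite -(@mulKr _ x x0 y) -(@mulrVK _ x x0 (x * y)) E mul1r.
by rewrite mulVr.
Qed.

Lemma ratio_eq1 (A B C D : quaternion R) : A != 0 -> B != 0 -> D != 0 ->
  A * B^-1 * C * D^-1 = 1 -> C = B * (A^-1 * D).
Proof.
move=> A0 B0 D0 E; have : A^-1 * (A * B^-1 * C * D^-1 * D) = A^-1 * D.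
  by rewrite E mul1r.
by rewrite mulrVK // -(mulrA A) mulKr // => <-; rewrite mulVKr.
Qed.

Lemma ratio_eq1_tilde (A B C D : quaternion R) : A != 0 -> B != 0 -> D != 0 ->
  A^-1 * C * B^-1 * D = 1 -> C = A * D^-1 * B.
Proof.
move=> A0 B0 D0 E; have : A * (A^-1 * C * B^-1 * D * D^-1) * B = A * D^-1 * B.
  by rewrite E mul1r.
by rewrite mulrK // mulrA mulrVK // mulVKr.
Qed.

Section Pole.
Variables P1 P2 P3 P4 P5 P6 : quaternion R.
Hypotheses (n1 : P1 != P2) (n3 : P3 != P2) (n4 : P4 != P2) (n5 : P5 != P2)
  (n6 : P6 != P2) (n34 : P3 != P4) (n45 : P4 != P5) (n61 : P6 != P1).
Let y1 := (P1 - P2)^-1.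
Let y3 := (P3 - P2)^-1.
Let y4 := (P4 - P2)^-1.
Let y5 := (P5 - P2)^-1.
Let y6 := (P6 - P2)^-1.

Let subE (x y : quaternion R) : x - y = (x - P2) - (y - P2).
Proof. by rewrite opprB addrA subrK. Qed.

Let invB (x y : quaternion R) : x != P2 -> y != P2 -> x != y ->
  (x - P2)^-1 - (y - P2)^-1 != 0.
Proof.
move=> x2 y2; apply: contraNneq => /eqP; rewrite subr_eq0 => /eqP/invr_inj/addIr.
by move=> ->.
Qed.

(** After cancellation the multi-ratio is, up to sign, a product of four differences of the [y]'s
    and their inverses, conjugated by [P1 - P2]; the conjugation disappears because the value is
    central. *)
Lemma multiratio_pole : multiratio P1 P2 P3 P4 P5 P6 = -1 ->
  y5 - y6 = (y4 - y5) * ((y3 - y4)^-1 * (y6 - y1)).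
Proof.
have x1 : P1 - P2 != 0 by rewrite subr_eq0.
have x3 : P3 - P2 != 0 by rewrite subr_eq0.
have x4 : P4 - P2 != 0 by rewrite subr_eq0.
have x5 : P5 - P2 != 0 by rewrite subr_eq0.
have x6 : P6 - P2 != 0 by rewrite subr_eq0.
have d43 : y4 - y3 != 0 by apply: invB; rewrite // eq_sym.
have d54 : y5 - y4 != 0 by apply: invB; rewrite // eq_sym.
have d16 : y1 - y6 != 0 by apply: invB; rewrite // eq_sym.
rewrite /multiratio -[P2 - P3]opprB invrN mulrN !mulNr => /oppr_inj.
rewrite (subE P3) (subE P4 P5) (subE P5 P6) (subE P6 P1).
rewrite (sub_inv x3 x4) (sub_inv_swap x4 x5) (sub_inv x5 x6) (sub_inv_swap x6 x1).
rewrite -/y1 -/y3 -/y4 -/y5 -/y6 !qinvM => E0.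
have {}E0 : (P1 - P2) * ((y4 - y3) / (y5 - y4) * (y6 - y5) / (y1 - y6)) / (P1 - P2) = 1.
  by rewrite -E0 !mulrA mulrVK // mulrK // mulrVK // mulrK.
have E := ratio_eq1 d43 d54 d16 (conj_eq1 x1 E0).
by rewrite -[y5 - y6]opprB E -[y5 - y4]opprB -[y4 - y3]opprB -[y1 - y6]opprB
  invrN mulNr mulrN !mulNr !opprK.
Qed.

(** The same cancellation yields the three factors of [multiratio_pole] in reverse order. *)
Lemma multiratio_tilde_pole : multiratio_tilde P1 P2 P3 P4 P5 P6 = -1 ->
  y5 - y6 = ((y6 - y1) * (y3 - y4)^-1) * (y4 - y5).
Proof.
have x1 : P1 - P2 != 0 by rewrite subr_eq0.
have x3 : P3 - P2 != 0 by rewrite subr_eq0.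
have x4 : P4 - P2 != 0 by rewrite subr_eq0.
have x5 : P5 - P2 != 0 by rewrite subr_eq0.
have x6 : P6 - P2 != 0 by rewrite subr_eq0.
have d34 : y3 - y4 != 0 by apply: invB.
have d45 : y4 - y5 != 0 by apply: invB.
have d61 : y6 - y1 != 0 by apply: invB.
rewrite /multiratio_tilde -[P2 - P1]opprB mulrN => /oppr_inj.
rewrite (subE P1 P6) (subE P6 P5) (subE P5 P4) (subE P4 P3).
rewrite (sub_inv_swap x1 x6) (sub_inv x6 x5) (sub_inv_swap x5 x4) (sub_inv x4 x3).
rewrite -/y1 -/y3 -/y4 -/y5 -/y6 !qinvM => E0.
have x1V : (P1 - P2)^-1 != 0 by rewrite invr_eq0.
have {}E0 : (P1 - P2)^-1 * ((y6 - y1)^-1 * (y5 - y6) / (y4 - y5) * (y3 - y4)) /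
    (P1 - P2)^-1 = 1.
  by rewrite -E0 invrK !mulrA mulrVK // mulrVK // mulrK // mulrK.
exact: (ratio_eq1_tilde d61 d45 d34 (conj_eq1 x1V E0)).
Qed.

End Pole.

(** Writes a hyperplane reflection through conjugation, which reverses products; hence the exchange
    of the two multi-ratio equations. *)
Lemma reflection_conj n x : dot n n = 1 ->
  x - (2 * dot n x) *: n = - (n * qconj x * n).
Proof.
move=> n1; rewrite -[x in x - _]scale1r -[X in X *: x]n1.
by apply: quat_eqP; rewrite /qconj !dotE !qE; ring.
Qed.

(** The real part of [n * qconj x] is [dot n x], so the product is imaginary and equals minus its
    conjugate. *)
Lemma dot0_conj n x : dot n x = 0 -> n * qconj x = - (x * qconj n).
Proof.
move=> nx; apply: quat_eqP; move: nx; rewrite /qconj dotE !qE; lra.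
Qed.

Lemma dot0_conjl n x : dot n x = 0 -> qconj n * x = - (qconj x * n).
Proof.
move=> nx; apply: quat_eqP; move: nx; rewrite /qconj dotE !qE; lra.
Qed.

Lemma qconjM x y : qconj (x * y) = qconj y * qconj x.
Proof. by apply: quat_eqP; rewrite /qconj !qE; ring. Qed.

Lemma qconjK x : qconj (qconj x) = x.
Proof. by apply: quat_eqP; rewrite /qconj !qE; ring. Qed.

Lemma qconjZ k x : qconj (k *: x) = k *: qconj x.
Proof. by apply: quat_eqP; rewrite /qconj !qE; ring. Qed.

(** Conjugation reverses the product, and moving [n] past [qconj w] and [v] changes the sign
    twice. *)
Lemma reflection_mul n v w z : dot n n = 1 -> dot n v = 0 -> dot n w = 0 ->
  z * (v^-1 * w) - (2 * dot n (z * (v^-1 * w))) *: n =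
  w * v^-1 * (z - (2 * dot n z) *: n).
Proof.
move=> n1 nv nw; rewrite !reflection_conj //.
rewrite qinvE -!qscaleAl -!qscaleAr -qscaleAl qconjZ -qscaleAr -qscaleAl -scalerN.
congr (_ *: _); rewrite !qconjM qconjK mulrN; congr (- _).
rewrite !mulrA (dot0_conj nw) !mulNr -[w * qconj n * v]mulrA (dot0_conjl nv).
by rewrite mulrN !mulNr opprK !mulrA.
Qed.

Lemma multiratio_reflection (n a c e e' v w : quaternion R) : dot n n = 1 ->
  dot n v = 0 -> dot n w = 0 -> dot n (c - a) = 0 -> c != a ->
  e - a = (c - e) * (v^-1 * w) -> e' - a = (w * v^-1) * (c - e') ->
  e' = e - (2 * dot n (e - a)) *: n.
Proof.
(* [e2] is the mirror image of [e] in the hyperplane through [a] and [c] with normal [n]. *)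
move=> n1 nv nw nca ca eE e'E; set e2 := e - _.
have e2E : e2 - a = w * v^-1 * (c - e2).
  have -> : c - e2 = (c - e) - (2 * dot n (c - e)) *: n.
    have -> : dot n (c - e) = - dot n (e - a).
      by have := nca; rewrite !(dotDr, dotNr); lra.
    by rewrite mulrN scaleNr opprK /e2 opprB addrCA addrC.
  rewrite -reflection_mul // -eE /e2 addrAC; congr (_ - _).
clearbody e2.
have H : (1 + w * v^-1) * (e' - e2) = 0.
  rewrite mulrDl mul1r (_ : e' - e2 = (e' - a) - (e2 - a)); last by rewrite opprB addrA subrK.
  rewrite [X in X + _](_ : _ = w * v^-1 * (e2 - e')).
    by rewrite -mulrDr [e' - a - _](_ : _ = e' - e2)
      ?addrA ?subrK ?subrr ?mulr0 // opprB addrA subrK.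
  rewrite e'E e2E -mulrBr; congr (_ * _).
  by rewrite opprB addrC addrA subrK.
move/eqP: H; rewrite qmulf_eq0 => /orP[/eqP h|]; last by rewrite subr_eq0 => /eqP.
(* If the factor [1 + w * v^-1] vanished, the second equation would read [e' - a = e' - c]. *)
move: e'E; have -> : w * v^-1 = -1 by apply: (addrI 1); rewrite h subrr.
by rewrite mulN1r opprB => /addrI/oppr_inj ac; move: ca; rewrite ac eqxx.
Qed.

End Multiratio.

(** * Hyperspheres through a fixed point and inversion in them *)

Section Hyperspheres.
Variable R : realType.
Implicit Types (x y z n m q : quaternion R) (s t k : R).

(* The hyperplane [dot (qconj m) y = k] in the coordinate [y = (x - q)^-1]. *)
Definition pencil_sphere q m k : hypersphere R :=
  if k == 0 then Hyperplane m (dot m q)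
  else Sphere (q + (2 * k)^-1 *: m) `|(2 * k)^-1|.

Lemma pencil_sphere_ok q m k : dot m m = 1 -> hypersphere_ok (pencil_sphere q m k).
Proof.
rewrite /pencil_sphere; case: eqP => //= /eqP k0 _.
by rewrite normr_gt0 invr_eq0 mulf_eq0 negb_or k0 andbT pnatr_eq0.
Qed.

Lemma Some_set (A : set (quaternion R)) x : [set Some x | x in A] (Some x) <-> A x.
Proof. by split=> [[y Ay [<-]]|Ax] //; exists x. Qed.

(** For nonzero [k] this is the sphere equation, expanded around [q] and multiplied by [k]; for
    [k = 0] it is a hyperplane through [q]. *)
Lemma pencil_sphere_mem q m k x : dot m m = 1 ->
  hypersphere_set (pencil_sphere q m k) (Some x) <->
  dot m (x - q) = k * dot (x - q) (x - q).
Proof.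
move=> m1; rewrite /pencil_sphere; case: eqP => [->|/eqP k0].
  rewrite /= mul0r dotDr dotNr; split=> [[//|/Some_set /= ->]|h]; first by rewrite subrr.
  by right; apply/Some_set => /=; lra.
rewrite /hypersphere_set Some_set /= opprD addrA; move: (x - q) => z.
rewrite real_normK ?num_real // !(dotDl, dotDr, dotNl, dotNr, dotZl, dotZr) m1.
rewrite [dot z m]dotC.
have E : dot z z - (2 * k)^-1 * dot m z +
    (- ((2 * k)^-1 * dot m z) - - ((2 * k)^-1 * ((2 * k)^-1 * 1))) =
  k^-1 * (k * dot z z - dot m z) + (2 * k)^-1 ^+ 2 by field.
split=> h.
  have : k^-1 * (k * dot z z - dot m z) = 0 by lra.
  by move/eqP; rewrite mulf_eq0 invr_eq0 (negbTE k0) subr_eq0 eq_sym => /eqP.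
by rewrite E h subrr mulr0 add0r.
Qed.

Lemma pencil_sphere_None q m k :
  hypersphere_set (pencil_sphere q m k) None <-> k = 0.
Proof.
rewrite /pencil_sphere; case: eqP => [->|k0] /=; first by split=> // _; left.
by split=> // -[].
Qed.

Lemma hypersphere_pencil (H : hypersphere R) q : hypersphere_ok H ->
  hypersphere_set H (Some q) -> exists m k, [/\ m != 0,
    forall x, hypersphere_set H (Some x) <-> dot m (x - q) = k * dot (x - q) (x - q) &
    hypersphere_set H None <-> k = 0].
Proof.
case: H => [c r|n d] ok.
  (* Expanding [|x - c|^2 = |q - c|^2] around [q] gives the equation with [m = 2 (c - q)] and
     [k = 1]. *)
  move=> /Some_set qH; rewrite /= in qH; exists (2 *: (c - q)), 1; split.
  - rewrite scaler_eq0 pnatr_eq0 /= -dot_gt0 -opprB dotNl dotNr opprK qH.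
    by rewrite exprn_gt0.
  - move=> x; rewrite /hypersphere_set Some_set /= -qH.
    rewrite !(dotDl, dotDr, dotNl, dotNr, dotZl, dotZr).
    rewrite ![dot x c]dotC ![dot q c]dotC ![dot q x]dotC; split; lra.
  - by split=> [[]//|/eqP]; rewrite oner_eq0.
case=> // /Some_set /= qH; exists n, 0; split.
- by rewrite -dot_gt0 ok.
- move=> x; rewrite mul0r dotDr dotNr qH; split=> [[//|/Some_set /= ->]|h].
    by rewrite subrr.
  by right; apply/Some_set => /=; lra.
- by split=> // _; left.
Qed.

(** Inverting the reflected point explicitly gives [z' = g / D], and the formula for the inversion
    in the sphere or hyperplane gives the same. *)
Lemma inversion_pencil_sphere q m k z z' (n := qconj m) :
  dot m m = 1 -> z != 0 -> z' != 0 ->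
  z'^-1 = z^-1 - (2 * (dot n z^-1 - k)) *: n ->
  inversion (pencil_sphere q m k) (Some (q + z)) = Some (q + z').
Proof.
move=> m1 z0 z'0 y'E.
rewrite -[z' in RHS]invrK.
have y'0 : z'^-1 != 0 by rewrite invr_eq0.
pose N := dot z z; have N0 : N != 0 by rewrite dot_eq0.
pose s := dot m z.
(* For nonzero [k], [D / (2 k)^2] is the squared distance of [q + z] from the centre of the
   sphere. *)
pose D := 1 - 4 * k * s + 4 * k ^+ 2 * N.
pose g : quaternion R := z - (2 * (s - k * N)) *: m.
have nyE : dot n z^-1 = s / N.
  by rewrite qinvE -/N dotZr /s /n /qconj !dotE !qE mulrC; congr (_ * _); ring.
have y'g : z'^-1 = N^-1 *: qconj g.
  rewrite y'E nyE qinvE -/N /g /n; move: (s) (N) N0 => s1 N1 N10.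
  by apply: quat_eqP; rewrite /qconj !qE; field.
have ggE : dot g g = N * D.
  rewrite /g !(dotDl, dotDr, dotNl, dotNr, dotZl, dotZr) m1 [dot z m]dotC -/s -/N /D.
  by ring.
have D0 : D != 0.
  apply: contraNneq y'0 => D0; rewrite y'g.
  have /eqP -> : g == 0 by rewrite -dot_eq0 ggE D0 mulr0.
  rewrite scaler_eq0 invr_eq0 (negbTE N0) /=.
  by apply/eqP/quat_eqP; rewrite /qconj !qE; ring.
have -> : (z'^-1)^-1 = D^-1 *: g.
  rewrite y'g qscale_inv invrK qinvE qconjK.
  have -> : dot (qconj g) (qconj g) = N * D by rewrite -ggE /qconj !dotE !qE; ring.
  by rewrite scalerA invfM mulrA divff ?mul1r.
rewrite /inversion /pencil_sphere; case: eqP => [k0|/eqP k0].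
  have D1 : D = 1 by rewrite /D k0; ring.
  have g1 : g = z - (2 * s) *: m by rewrite /g k0 mul0r subr0.
  by rewrite D1 invr1 scale1r g1 dotDr [dot m q + _]addrC addrK addrA.
have xq : q + z - (q + (2 * k)^-1 *: m) = z - (2 * k)^-1 *: m.
  by rewrite opprD addrACA subrr add0r.
have dE : dot (z - (2 * k)^-1 *: m) (z - (2 * k)^-1 *: m) = D / (2 * k) ^+ 2.
  rewrite !(dotDl, dotDr, dotNl, dotNr, dotZl, dotZr) m1 [dot z m]dotC -/s -/N /D.
  by field.
have -> : (q + z == q + (2 * k)^-1 *: m) = false.
  rewrite -subr_eq0 xq -dot_eq0 dE mulf_eq0 (negbTE D0) /= invr_eq0.
  by rewrite expf_eq0 /= mulf_eq0 (negbTE k0) pnatr_eq0.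
rewrite xq dE real_normK ?num_real // /g; congr Some; rewrite -addrA; congr (_ + _).
have -> : (2 * k)^-1 ^+ 2 / (D / (2 * k) ^+ 2) = D^-1.
  by field; rewrite D0 k0.
apply: (scalerI D0); rewrite scalerDr !scalerA !(divff D0) !scale1r.
by apply: quat_eqP; rewrite !qE /D; field.
Qed.

End Hyperspheres.

(** * Orthogonal complements in dimension four *)

Section Rank.
Variable R : realType.
Implicit Types (v w z n : quaternion R).

Lemma mul_tr_dot v w : (v : 'rV_4) *m (w : 'rV_4)^T = (dot v w)%:M.
Proof.
by apply/rowP => i; rewrite !mxE ord1 eqxx mulr1n; apply: eq_bigr => j _; rewrite mxE.
Qed.

Lemma independent2_row_free v w : independent2 v w ->
  row_free (col_mx (v : 'rV_4) (w : 'rV_4)).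
Proof.
move=> vw; apply: inj_row_free => u.
rewrite -[u]hsubmxK mul_row_col [lsubmx u]mx11_scalar [rsubmx u]mx11_scalar.
rewrite !mul_scalar_mx => /vw[-> ->].
by rewrite !raddf0 row_mx0.
Qed.

(** The orthogonal complement of [n] and [n'] has dimension 2 and contains the independent vectors
    [w] and [v], which therefore span it. *)
Lemma orthogonal_plane n n' v w z : independent2 n n' -> independent2 w v ->
  dot n v = 0 -> dot n w = 0 -> dot n z = 0 ->
  dot n' v = 0 -> dot n' w = 0 -> dot n' z = 0 ->
  exists s t, z = s *: v + t *: w.
Proof.
move=> nn' wv nv nw nz n'v n'w n'z.
pose N := col_mx (n : 'rV_4) (n' : 'rV_4).
pose A := col_mx (w : 'rV_4) (v : 'rV_4).
have zero x : dot n x = 0 -> dot n' x = 0 -> (x : 'rV_4) *m N^T = 0.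
  move=> nx n'x; rewrite tr_col_mx mul_mx_row !mul_tr_dot dotC nx dotC n'x.
  by rewrite !raddf0 row_mx0.
have AK : (A <= kermx N^T)%MS.
  by apply/sub_kermxP; rewrite mul_col_mx !zero // col_mx0.
have rA : \rank A = 2 by apply/eqP; exact: independent2_row_free.
have rK : \rank (kermx N^T) = 2.
  by rewrite mxrank_ker mxrank_tr (eqP (independent2_row_free nn')).
have /mxrank_leqif_eq[_ /esym] := AK; rewrite rA rK eqxx => /eqmxP AE.
have : ((z : 'rV_4) <= A)%MS by rewrite AE; apply/sub_kermxP; exact: zero.
case/submxP => D zE; exists (rsubmx D 0 0), (lsubmx D 0 0).
rewrite zE -[D]hsubmxK mul_row_col [lsubmx D]mx11_scalar [rsubmx D]mx11_scalar.
by rewrite !mul_scalar_mx addrC row_mxKl row_mxKr !mxE eqxx !mulr1n.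
Qed.

(** Three linear equations in four unknowns have a nonzero solution, which is then normalised. *)
Lemma exists_orthogonal3 u v w : exists n : quaternion R,
  [/\ dot n n = 1, dot n u = 0, dot n v = 0 & dot n w = 0].
Proof.
pose A := col_mx (u : 'rV_4) (col_mx (v : 'rV_4) (w : 'rV_4)).
have /rowV0Pn[x /sub_kermxP xA x0] : kermx A^T != 0.
  by rewrite -mxrank_eq0 mxrank_ker mxrank_tr -lt0n subn_gt0 (leq_ltn_trans (rank_leq_row A)).
have [N [n [N0 n1 xE _]]] := @exists_unit R x x0.
have nK y : (x *m (y : 'rV_4)^T = 0) -> dot n y = 0.
  rewrite mul_tr_dot xE dotZl => /(congr1 (fun M : 'M[R]_1 => M 0 0)).
  by rewrite !mxE eqxx mulr1n => /eqP; rewrite mulf_eq0 (gt_eqF N0) => /eqP.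
move: xA; rewrite !tr_col_mx !mul_mx_row -[RHS]row_mx0 => /eq_row_mx[xu].
rewrite -[RHS]row_mx0 => /eq_row_mx[xv xw].
by exists n; split=> //; exact: nK.
Qed.

End Rank.

(** * The common hypersphere, its uniqueness and the inversion *)

Lemma dot_qconj_inv (R : realType) (m x : quaternion R) (k : R) : x != 0 ->
  dot m x = k * dot x x <-> dot (qconj m) x^-1 = k.
Proof.
rewrite -dot_eq0 => x0.
have -> : dot (qconj m) x^-1 = dot m x / dot x x.
  by rewrite qinvE dotZr mulrC; congr (_ * _); rewrite /qconj !dotE !qE; ring.
by split=> [->|<-]; [rewrite mulfK | rewrite divfK].
Qed.

Lemma dependent2 (R : realType) (n n' : quaternion R) : dot n n = 1 ->
  ~ independent2 n n' -> n' = dot n n' *: n.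
Proof.
move=> n1 nn'; apply: contrapT => ne; apply: nn' => s t st.
have n0 : n != 0 by rewrite -dot_gt0 n1.
have [t0|t0] := eqVneq t 0.
  split=> //; move/eqP: st; rewrite t0 scale0r addr0 scaler_eq0 (negbTE n0) orbF.
  by move/eqP.
case: ne; have n'E : n' = (- (s / t)) *: n.
  apply: (scalerI t0); rewrite scalerA mulrN mulrCA divff // mulr1.
  by apply/eqP; rewrite scaleNr -addr_eq0 addrC st.
by rewrite {1}n'E [in RHS]n'E dotZr n1 mulr1.
Qed.

Theorem corollary6p5 (R : realType)
  (Phi Phi' : vertex -> quaternion R) (S S' : face -> ocircle R)
  (cliff : generalized_clifford Phi S)
  (cliff' : generalized_clifford Phi' S')
  (common : forall v : vertex, v <> V34 -> Phi' v = Phi v)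
  (multi : multiratio (Phi V14) (Phi V12) (Phi V24)
                      (Phi V23) (Phi V34) (Phi V13) = -1)
  (multi' : multiratio_tilde (Phi V14) (Phi V12) (Phi V24)
                             (Phi V23) (Phi' V34) (Phi V13) = -1)
  (nonclassical : ~ conformally_classical Phi S)
  (nonclassical' : ~ conformally_classical Phi' S') :
  exists H : hypersphere R,
    [/\ hypersphere_ok H,
        forall v : vertex, v <> V34 -> hypersphere_set H (Some (Phi v)),
        forall H' : hypersphere R, hypersphere_ok H' ->
          (forall v : vertex, v <> V34 -> hypersphere_set H' (Some (Phi v))) ->
          hypersphere_set H' = hypersphere_set H &
        inversion H (Some (Phi V34)) = Some (Phi' V34)].
Proof.
have [oct _ _] := cliff; have [Phi_inj _ _] := oct.
have [[Phi'_inj _ _] _ _] := cliff'.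
have ne i j : i <> j -> Phi i != Phi j by move=> ij; apply/eqP => /Phi_inj.
have ne' i : i <> V34 -> Phi i != Phi' V34.
  by move=> i34; rewrite -common //; apply/eqP => /Phi'_inj.
pose q := Phi V12; pose y i := (Phi i - q)^-1.
have eE : y V34 - y V13 = (y V23 - y V34) * ((y V24 - y V23)^-1 * (y V13 - y V14)).
  by apply: multiratio_pole multi; exact: ne.
have ne34 : Phi' V34 != Phi V12 by rewrite eq_sym ne'.
have e'E : (Phi' V34 - q)^-1 - y V13 =
    (y V13 - y V14) * (y V24 - y V23)^-1 * (y V23 - (Phi' V34 - q)^-1).
  by apply: multiratio_tilde_pole multi'; rewrite ?ne ?ne'.
have nd := multiratio_coplanar_classical oct eE.
have y0 i : i <> V12 -> Phi i - q != 0 by move=> i12; rewrite subr_eq0 ne.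
set w := y V13 - y V14; set v := y V24 - y V23.
(* [w], [v] and [c - a] span all differences of a, b, c, d, so [n] is normal to a hyperplane
   containing these four images. *)
have [n [n1 nw nv nca]] := exists_orthogonal3 w v (y V23 - y V13).
pose k := dot n (y V13).
have m1 : dot (qconj n) (qconj n) = 1 by rewrite -n1 /qconj !dotE !qE; ring.
have nyE i : i <> V12 -> i <> V34 -> dot n (y i) = k.
  move: nw nv nca; rewrite /w /v !dotDr !dotNr -/k.
  by case: i => // h1 h2 h3 _ _ //; lra.
exists (pencil_sphere q (qconj n) k); split.
- exact: pencil_sphere_ok.
- move=> i i34; apply/pencil_sphere_mem => //.
  have [->|i12] : i = V12 \/ i <> V12 by case: (i); [left|right..].
    by rewrite subrr !dotE !qE; ring.
  by apply/dot_qconj_inv; rewrite ?y0 // qconjK; apply: nyE.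
- move=> H' H'ok H'mem.
  have [m' [k' [m'0 memE NE]]] := @hypersphere_pencil _ H' q H'ok (H'mem V12 ltac:(by [])).
  pose n' := qconj m'.
  have n'yE i : i <> V12 -> i <> V34 -> dot n' (y i) = k'.
    by move=> i12 i34; apply/dot_qconj_inv; [exact: y0 | apply/memE/H'mem].
  (* Two independent normals would put a, b, c, d into a plane and make the configuration classical;
     hence [n'] is a multiple of [n]. *)
  have [nn'|/(dependent2 n1) n'E] := pselect (independent2 n n').
    exfalso; apply/nonclassical/nd; rewrite -/w -/v.
    have v0 : v != 0.
      rewrite subr_eq0; apply/eqP => /invr_inj/addIr/eqP.
      by apply/negP/ne.
    have [[t wt]|nwt] := pselect (exists t, w = t *: v); [by left; exists t|right].
    have wv : independent2 w v.
      move=> s t st; have [s0|s0] := eqVneq s 0.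
        split=> //; move/eqP: st.
        by rewrite s0 scale0r add0r scaler_eq0 (negbTE v0) orbF => /eqP.
      case: nwt; exists (- (t / s)); apply: (scalerI s0).
      rewrite scalerA mulrN mulrCA divff // mulr1.
      by apply/eqP; rewrite scaleNr -addr_eq0 st.
    split=> //; apply: (orthogonal_plane nn' wv) => //.
    + by rewrite dotDr dotNr !n'yE // subrr.
    + by rewrite dotDr dotNr !n'yE // subrr.
    + by rewrite dotDr dotNr !n'yE // subrr.
  set l := dot n n' in n'E.
  (* The equation of [H'] is [l] times that of the constructed hypersphere, and [l] is nonzero
     because [m'] is. *)
  have m'E : m' = l *: qconj n by rewrite -qconjZ -n'E qconjK.
  have k'E : k' = l * k by rewrite -(n'yE V13) // n'E dotZl.
  have l0 : l != 0 by apply: contraNneq m'0 => l0; rewrite m'E l0 scale0r.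
  apply/seteqP; split=> -[x|] /=.
  + move=> /memE h; apply/pencil_sphere_mem => //; apply: (mulfI l0).
    by move: h; rewrite m'E k'E dotZl mulrA.
  + move=> /NE h; apply/pencil_sphere_None/(mulfI l0).
    by rewrite mulr0 -k'E.
  + move=> /(pencil_sphere_mem _ _ _ m1) h; apply/memE.
    by rewrite m'E k'E dotZl h mulrA.
  + by move=> /pencil_sphere_None h; apply/NE; rewrite k'E h mulr0.
(* Measured from [q], the two points have inverses that are mirror images in the hyperplane
   [dot n y = k], by [multiratio_reflection]. *)
- rewrite -[Phi V34](subrK q) -[Phi' V34](subrK q) ![_ - q + q]addrC.
  apply: inversion_pencil_sphere => //; first exact: y0.
    by rewrite subr_eq0.
  rewrite qconjK (multiratio_reflection n1 nv nw nca _ eE e'E); last first.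
    by apply/eqP => /invr_inj/addIr/eqP; apply/negP/ne.
  by rewrite dotDr dotNr.
Qed.
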